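(* Let $N\ge 1$. Consider the two-dimensional compressible Euler equations $\partial_t\mathbf U+\partial_x\mathbf f(\mathbf U)+\partial_y\mathbf g(\mathbf U)=0$ (ideal gas, $\gamma=1.4$) with periodic boundary conditions, on a watertight isoparametric curvilinear quadrilateral mesh $\{\Omega_e\}_{e=1}^{N_e}$ with $2{:}1$ nonconforming interfaces. Let $\{\mathbf U^e_{ij}(t)\}$ be the solution of the semi-discrete entropy-stable DGSEM (defined in the context), with the local Lax--Friedrichs flux on conforming interfaces and the sign-modified projected fluxes on the fine and coarse sides of nonconforming interfaces. Assume that the numerical fluxes are entropy stable in the following sense. (i) On conforming interfaces, $$(\mathbf V_R-\mathbf V_L)\cdot\bigl(\mathbf F^*(\mathbf U_L,\mathbf U_R)\cdot\mathbf n\bigr)-(\boldsymbol\psi_R-\boldsymbol\psi_L)\cdot\mathbf n\le 0,$$ where $\mathbf n$ is the metric-scaled normal vector oriented from the left state to the right state. (ii) On nonconforming interfaces, for all $0\le i,j\le N$ and $k=1,2$, $$(P_{C\to F_k})_{ij}\Bigl[(\mathbf V_i^{F_k}-\mathbf V_j^{C})\cdot\bigl(\mathbf F^\star(\mathbf U_i^{F_k},\mathbf U_j^C)\cdot\mathbf n_{ij}^{F_k,C}\bigr)-(\boldsymbol\psi_i^{F_k}-\boldsymbol\psi_j^{C})\cdot\mathbf n_{ij}^{F_k,C}\Bigr]\le 0 .$$ Then the scheme is globally conservative, $$\sum_{e=1}^{N_e}\sum_{i,j=0}^N w_iw_j\,\mathcal J^e_{ij}\,\partial_t\mathbf U^e_{ij}=\mathbf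 0,$$ and satisfies the semi-discrete entropy inequality $$\sum_{e=1}^{N_e}\sum_{i,j=0}^N w_iw_j\,\mathcal J^e_{ij}\,\partial_t\eta(\mathbf U^e_{ij})\le 0 .$$
   Context: **Euler equations.** $\mathbf U=(\rho,\rho u,\rho v,E)^T$, $\mathbf u=(u,v)$, $p=(\gamma-1)\bigl(E-\tfrac12\rho|\mathbf u|^2\bigr)$, $\gamma=1.4$, sound speed $c=\sqrt{\gamma p/\rho}$, $\mathbf f(\mathbf U)=(\rho u,\rho u^2+p,\rho uv,(E+p)u)^T$, $\mathbf g(\mathbf U)=(\rho v,\rho uv,\rho v^2+p,(E+p)v)^T$. For $\mathbf n=(n_1,n_2)\in\mathbb R^2$, $\mathbf F(\mathbf U)\cdot\mathbf n:=n_1\mathbf f(\mathbf U)+n_2\mathbf g(\mathbf U)$. Entropy: $\eta(\mathbf U)=-\rho s/(\gamma-1)$, $s=\log(p\rho^{-\gamma})$; entropy variables $\mathbf V=\partial\eta/\partial\mathbf U$; entropy potential $\boldsymbol\psi=(\psi^f,\psi^g)=\rho\mathbf u$. Sub/superscripts on $\mathbf V,\boldsymbol\psi$ denote evaluation at the state with the same sub/superscripts. **Nodes.** $\{\xi_i\}_{i=0}^N$: Legendre--Gauss--Lobatto (LGL) nodes on $[-1,1]$, $w_i$ the LGL weights, $\phi_i$ the Lagrange basis, $D_{ij}=\phi_j'(\xi_i)$. **Mesh.** Each element $\Omega_e$ is the image of $[-1,1]^2$ under a map $(x^e,y^e)(\xi,\eta)$ whose components lie in $\mathbb Q_N$ (tensor-product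 polynomials of degree $\le N$ in each variable; isoparametric), with Jacobian $\mathcal J^e=x^e_\xi y^e_\eta-x^e_\eta y^e_\xi$; subscript $ij$ denotes evaluation at $(\xi_i,\xi_j)$. The metric-scaled outward normal on $\partial\Omega_e$ is $\mathbf n=\mathcal J^e(G^e)^{-T}\hat{\mathbf n}$, where $G^e=\begin{pmatrix}x^e_\xi&x^e_\eta\\ y^e_\xi&y^e_\eta\end{pmatrix}$ and $\hat{\mathbf n}$ is the outward unit normal of $[-1,1]^2$. On each edge it is a polynomial of degree $\le N-1$ in the edge coordinate. By periodicity every edge is one of the following. - *Conforming:* shared by two elements, with edge nodes coinciding and opposite metric-scaled normals. - *Part of a nonconforming interface:* two fine edges $E_{F_1},E_{F_2}$ (edges of fine elements $\Omega_{F_1},\Omega_{F_2}$) which together form one coarse edge $E_C$ of an element $\Omega_C$. In the reference coordinate of $E_C$ (identified with $[-1,1]$), $E_{F_1},E_{F_2}$ correspond to $[-1,0],[0,1]$, with fine nodes $\xi_i^1=(\xi_i-1)/2$, $\xi_i^2=(\xi_i+1)/2$. Nodal states and outward metric-scaled normals are denoted $\mathbf U_i^{F_k},\mathbf n_i^{F_k}$ on $E_{F_k}$ and $\mathbf U_j^C,\mathbf n_j^C$ on $E_C$. The mesh is watertight: unit normals from the two sides are equal and opposite at the same physical point. Consequently $\sum_j\phi_j(\xi_i^k)\mathbf n_j^C=\mathbf n^C(\xi_i^k)=-2\mathbf n_i^{F_k}$. **Volume fluxes.** $\mathbf F^\#=(\mathbf f^\#,\mathbf g^\#)$ is a two-point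 flux that is consistent ($\mathbf f^\#(\mathbf U,\mathbf U)=\mathbf f(\mathbf U)$, $\mathbf g^\#(\mathbf U,\mathbf U)=\mathbf g(\mathbf U)$), symmetric, and entropy conservative: $(\mathbf V_R-\mathbf V_L)\cdot\mathbf f^\#(\mathbf U_L,\mathbf U_R)=\psi^f_R-\psi^f_L$ and $(\mathbf V_R-\mathbf V_L)\cdot\mathbf g^\#(\mathbf U_L,\mathbf U_R)=\psi^g_R-\psi^g_L$ (Chandrashekar's flux). With $\{\!\{\cdot\}\!\}$ the arithmetic mean of the two nodal values, e.g. $\{\!\{x_\eta^e\}\!\}_{(i,m),j}=\tfrac12((x^e_\eta)_{ij}+(x^e_\eta)_{mj})$, $$(\widetilde{\mathbf f}^{e,\#})_{(i,m),j}=\{\!\{y^e_\eta\}\!\}_{(i,m),j}\mathbf f^\#(\mathbf U^e_{ij},\mathbf U^e_{mj})-\{\!\{x^e_\eta\}\!\}_{(i,m),j}\mathbf g^\#(\mathbf U^e_{ij},\mathbf U^e_{mj}),$$ $$(\widetilde{\mathbf g}^{e,\#})_{i,(j,n)}=-\{\!\{y^e_\xi\}\!\}_{i,(j,n)}\mathbf f^\#(\mathbf U^e_{ij},\mathbf U^e_{in})+\{\!\{x^e_\xi\}\!\}_{i,(j,n)}\mathbf g^\#(\mathbf U^e_{ij},\mathbf U^e_{in}).$$ Also $\widetilde{\mathbf f}^e=y^e_\eta\mathbf f(\mathbf U^e)-x^e_\eta\mathbf g(\mathbf U^e)$, $\widetilde{\mathbf g}^e=-y^e_\xi\mathbf f(\mathbf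 U^e)+x^e_\xi\mathbf g(\mathbf U^e)$ at nodes. **Scheme (DGSEM).** For all $e$ and $0\le i,j\le N$, $$w_iw_j\Bigl(\mathcal J^e_{ij}\partial_t\mathbf U^e_{ij}+2\sum_{m=0}^N D_{im}(\widetilde{\mathbf f}^{e,\#})_{(i,m),j}+2\sum_{n=0}^N D_{jn}(\widetilde{\mathbf g}^{e,\#})_{i,(j,n)}\Bigr)+w_i\bigl((\Delta\widetilde{\mathbf g}^e)_{i0}\delta_{j0}-(\Delta\widetilde{\mathbf g}^e)_{iN}\delta_{jN}\bigr)+w_j\bigl((\Delta\widetilde{\mathbf f}^e)_{0j}\delta_{i0}-(\Delta\widetilde{\mathbf f}^e)_{Nj}\delta_{iN}\bigr)=\mathbf 0,$$ with $\Delta\widetilde{\mathbf f}^e=\widetilde{\mathbf f}^e-\widetilde{\mathbf f}^{e,*}$, $\Delta\widetilde{\mathbf g}^e=\widetilde{\mathbf g}^e-\widetilde{\mathbf g}^{e,*}$. The interface fluxes are determined by requiring that $(\widetilde{\mathbf f}^{e,*},\widetilde{\mathbf g}^{e,*})\cdot\hat{\mathbf n}$ equals the numerical normal flux (in the direction of the outward metric-scaled normal of $\Omega_e$) at that edge node, given as follows. *Conforming edge:* $\mathbf F^*(\mathbf U^e,\mathbf U^{\rm nbr})\cdot\mathbf n=\tfrac12\bigl(\mathbf F(\mathbf U^e)\cdot\mathbf n+\mathbf F(\mathbf U^{\rm nbr})\cdot\mathbf n\bigr)-\tfrac{\alpha\|\mathbf n\|}2(\mathbf U^{\rm nbr}-\mathbf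 U^e)$, with $\alpha$ a suitable maximum wave-speed estimate, typically $\alpha=\max\{|\mathbf u_L\cdot\mathbf n_u|+c_L,\ |\mathbf u_R\cdot\mathbf n_u|+c_R\}$ with $\mathbf n_u=\mathbf n/\|\mathbf n\|$ and $L,R$ the two traces. *Nonconforming interface:* $(P_{C\to F_k})_{ij}=\phi_j(\xi_i^k)$; $P_{F_k\to C}=M_C^{-1}P_{C\to F_k}^TM_{F_k}$ with $M_C=\mathrm{diag}(w_i)$, $M_{F_k}=\tfrac12M_C$; $\mathbf n_{ij}^{F_k,C}=\tfrac12\bigl(\mathbf n_i^{F_k}-\tfrac12\mathbf n_j^C\bigr)$, the averaged normal oriented from the fine element toward the coarse element. The two-point flux is $$\mathbf F^\star(\mathbf U_i^{F_k},\mathbf U_j^C)\cdot\mathbf n_{ij}^{F_k,C}=\tfrac12\bigl(\mathbf F(\mathbf U_i^{F_k})+\mathbf F(\mathbf U_j^C)\bigr)\cdot\mathbf n_{ij}^{F_k,C}-\mathrm{sign}\bigl((P_{C\to F_k})_{ij}\bigr)\tfrac{\alpha_i^{F_k}\|\mathbf n_i^{F_k}\|}2(\mathbf U_j^C-\mathbf U_i^{F_k}),$$ with $\alpha_i^{F_k}$ a suitable estimate of the maximum wave speed, similar to the conforming case. The normal flux on the fine side at node $i$ of $E_{F_k}$ is $\mathbf F_i^{F_k,*}\cdot\mathbf n_i^{F_k}=\sum_{j=0}^N(P_{C\to F_k})_{ij}\,\mathbf F^\star(\mathbf U_i^{F_k},\mathbf U_j^C)\cdot\mathbf n_{ij}^{F_k,C}$.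 On the coarse side at node $j$ of $E_C$ it is $\mathbf F_j^{C,*}\cdot\mathbf n_j^C=-2\sum_{k=1}^2\sum_{i=0}^N(P_{F_k\to C})_{ji}\,\mathbf F^\star(\mathbf U_i^{F_k},\mathbf U_j^C)\cdot\mathbf n_{ij}^{F_k,C}$.
   Formalization: In (ii) the jumps are taken as coarse minus fine, V_j^C − V_i^{F_k} and ψ_j^C − ψ_i^{F_k}, to match the normal n_ij^{F_k,C} oriented from fine to coarse; with the printed fine-minus-coarse sign the entropy inequality fails. *)

(* Defs.v *)
From HB Require Import structures.
From mathcomp Require Import all_boot all_order all_algebra.
From mathcomp Require Import all_classical all_reals all_analysis.
Set Implicit Arguments.
Unset Strict Implicit.
Unset Printing Implicit Defensive.
Import Order.TTheory GRing.Theory Num.Theory.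
Import numFieldNormedType.Exports.
Local Open Scope ring_scope.

(* A state is the row (rho, rho u, rho v, E). *)
Definition state (R : realType) := 'rV[R]_4.

(* Plane vectors are columns, so that 2 x 2 matrices act on the left. *)
Definition vec2 (R : realType) := 'cV[R]_2.

Section Euler.
Variable R : realType.
Implicit Types (U V : state R) (n : vec2 R).

Definition mk_state (a b c d : R) : state R :=
  \row_(k < 4) nth 0 [:: a; b; c; d] k.

Definition mk_vec2 (a b : R) : vec2 R := \col_(k < 2) nth 0 [:: a; b] k.

Definition gamma : R := 14%:R / 10%:R.

Definition density U : R := U 0 0.
Definition momentum_x U : R := U 0 1.
Definition momentum_y U : R := U 0 2.
Definition energy U : R := U 0 3.
Definition vel_x U : R := momentum_x U / density U.
Definition vel_y U : R := momentum_y U / density U.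

Definition pressure U : R :=
  (gamma - 1) *
  (energy U - density U * (vel_x U ^+ 2 + vel_y U ^+ 2) / 2%:R).

(* The states at which the entropy is meaningful: positive density and
   positive pressure. *)
Definition admissible U : Prop := 0 < density U /\ 0 < pressure U.

Definition flux_f U : state R :=
  mk_state (momentum_x U) (momentum_x U * vel_x U + pressure U)
    (momentum_x U * vel_y U) ((energy U + pressure U) * vel_x U).

Definition flux_g U : state R :=
  mk_state (momentum_y U) (momentum_y U * vel_x U)
    (momentum_y U * vel_y U + pressure U) ((energy U + pressure U) * vel_y U).

Definition normal_flux U n : state R :=
  n 0 0 *: flux_f U + n 1 0 *: flux_g U.

Definition specific_entropy U : R :=
  ln (pressure U * density U `^ (- gamma)).

Definition entropy U : R :=
  - (density U * specific_entropy U) / (gamma - 1).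

(* The gradient of the entropy: entry k is the partial derivative with respect
   to the k-th conserved variable. *)
Definition entropy_vars U : state R :=
  \row_(k < 4) 'D_(delta_mx 0 k : 'rV[R]_4) entropy U.

Definition potential_f U : R := momentum_x U.
Definition potential_g U : R := momentum_y U.
Definition potential U : vec2 R := mk_vec2 (potential_f U) (potential_g U).

Definition dot d (a b : 'I_d -> R) : R := \sum_(k < d) a k * b k.
Definition dot_state U V : R := dot (U 0) (V 0).
Definition dot2 (a b : vec2 R) : R := dot (a ^~ 0) (b ^~ 0).

(* The Euclidean norm; the library norm on matrices is the sup norm. *)
Definition enorm n : R := Num.sqrt (dot2 n n).

Definition consistent_flux (F : state R -> state R)
    (Fsharp : state R -> state R -> state R) : Prop :=
  forall U, admissible U -> Fsharp U U = F U.

Definition symmetric_flux (Fsharp : state R -> state R -> state R) : Prop :=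
  forall UL UR, admissible UL -> admissible UR -> Fsharp UL UR = Fsharp UR UL.

Definition entropy_conservative_flux (psi : state R -> R)
    (Fsharp : state R -> state R -> state R) : Prop :=
  forall UL UR, admissible UL -> admissible UR ->
    dot_state (entropy_vars UR - entropy_vars UL) (Fsharp UL UR) =
    psi UR - psi UL.

Definition volume_flux (fsharp gsharp : state R -> state R -> state R) : Prop :=
  [/\ consistent_flux flux_f fsharp /\ consistent_flux flux_g gsharp,
      symmetric_flux fsharp /\ symmetric_flux gsharp,
      entropy_conservative_flux potential_f fsharp &
      entropy_conservative_flux potential_g gsharp].

(* Local Lax--Friedrichs flux from the left state to the right state;
   [a] is the wave-speed estimate. *)
Definition llf_flux (a : R) UL UR n : state R :=
  2%:R^-1 *: (normal_flux UL n + normal_flux UR n)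
  - (a * enorm n / 2%:R) *: (UR - UL).

End Euler.

Section Nodes.
Variables (R : realType) (N : nat).

(* Legendre polynomial, by the Rodrigues formula. *)
Definition legendre : {poly R} :=
  ((2 ^ N * N`!)%N%:R)^-1 *: derivn N (('X ^+ 2 - 1) ^+ N).

(* The N+1 LGL nodes, in increasing order.  The polynomial below has degree
   N+1 when N >= 1 and it is (1 - X^2) P_N' with simple roots +1 and -1, so
   these conditions determine [xi]. *)
Definition LGL_nodes (xi : 'I_N.+1 -> R) : Prop :=
  {homo xi : i j / (i < j)%N >-> i < j} /\
  forall i, root ((1 - 'X ^+ 2) * deriv legendre) (xi i).

Variable xi : 'I_N.+1 -> R.

Definition lagrange_basis (i : 'I_N.+1) : {poly R} :=
  \prod_(j < N.+1 | j != i) ((xi i - xi j)^-1 *: ('X - (xi j)%:P)).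

Definition weight (i : 'I_N.+1) : R :=
  (\int[@lebesgue_measure R]_(x in `[(-1)%R, 1%R]) (lagrange_basis i).[x])%R.

Definition diffmx : 'M[R]_N.+1 :=
  \matrix_(i, j) (deriv (lagrange_basis j)).[xi i].

(* [half k] maps [-1,1] onto the k-th half of [-1,1]: k = 0 is [-1,0] and
   k = 1 is [0,1]. *)
Definition half (k : 'I_2) (s : R) : R :=
  if k == 0 then (s - 1) / 2%:R else (s + 1) / 2%:R.

(* Coarse-to-fine interpolation and fine-to-coarse projection. *)
Definition P_CF (k : 'I_2) : 'M[R]_N.+1 :=
  \matrix_(i, j) (lagrange_basis j).[half k (xi i)].
Definition mass_C : 'M[R]_N.+1 := diag_mx (\row_i weight i).
Definition mass_F : 'M[R]_N.+1 := 2%:R^-1 *: mass_C.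
Definition P_FC (k : 'I_2) : 'M[R]_N.+1 :=
  invmx mass_C *m (P_CF k)^T *m mass_F.

End Nodes.

(* Sides of the reference square: [(false, b)] is xi = +1 or -1 and
   [(true, b)] is eta = +1 or -1, with sign + exactly when [b] holds.  An edge
   is a side of an element; its edge coordinate in [-1,1] is the remaining
   reference coordinate of that element. *)
Definition side := (bool * bool)%type.
Definition edge (Ne : nat) := ('I_Ne * side)%type.

(* What lies across an edge.  The boolean says whether the edge coordinates of
   the two sides run in opposite directions; for k : 'I_2, k = 0 is the fine
   edge on [-1,0] of the coarse edge and k = 1 the one on [0,1]. *)
Inductive connection (Ne : nat) :=
| Conforming of edge Ne & bool
| FineOf of 'I_2 & edge Ne & bool
| CoarseOf of ('I_2 -> edge Ne) & ('I_2 -> bool).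
Arguments Conforming {Ne}.
Arguments FineOf {Ne}.
Arguments CoarseOf {Ne}.

(* The component maps are elements of R[xi][eta] in which the outer variable
   is xi and the inner variable is eta.  The columns of [period] generate the
   lattice of translations of the periodic domain. *)
Record mesh (R : realType) (Ne : nat) := Mesh {
  map_x : 'I_Ne -> {poly {poly R}};
  map_y : 'I_Ne -> {poly {poly R}};
  connect_edge : edge Ne -> connection Ne;
  period : 'M[R]_2 }.

Definition flip_coord (R : realType) (r : bool) (s : R) : R :=
  if r then - s else s.
(* The corresponding reversal of node numbers, the LGL nodes being symmetric. *)
Definition flip_node n (r : bool) (i : 'I_n) : 'I_n :=
  if r then rev_ord i else i.

Section Geometry.
Variables (R : realType) (Ne : nat) (M : mesh R Ne).
Implicit Types (e : 'I_Ne) (s : side) (E : edge Ne) (p : {poly {poly R}}).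

Definition eval2 p (x y : R) : R := (p.[x%:P]).[y].
Definition d_xi p : {poly {poly R}} := deriv p.
Definition d_eta p : {poly {poly R}} := map_poly (@deriv R) p.

(* Degree at most N in each variable. *)
Definition in_QN (N : nat) p : Prop :=
  (size p <= N.+1)%N /\ forall i, (size (p`_i)%R <= N.+1)%N.

Definition x_xi e := eval2 (d_xi (map_x M e)).
Definition x_eta e := eval2 (d_eta (map_x M e)).
Definition y_xi e := eval2 (d_xi (map_y M e)).
Definition y_eta e := eval2 (d_eta (map_y M e)).

Definition jacobian_mx e (x y : R) : 'M[R]_2 :=
  \matrix_(i < 2, j < 2)
    nth 0 (nth [::] [:: [:: x_xi e x y; x_eta e x y];
                        [:: y_xi e x y; y_eta e x y]] i) j.

Definition jac e (x y : R) : R :=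
  x_xi e x y * y_eta e x y - x_eta e x y * y_xi e x y.

Definition side_sign s : R := if s.2 then 1 else - 1.

Definition ref_normal s : vec2 R :=
  if s.1 then mk_vec2 0 (side_sign s) else mk_vec2 (side_sign s) 0.

(* Evaluation of a function of (xi, eta) at the point of side [s] with edge
   coordinate [t]. *)
Definition on_side (T : Type) s (h : R -> R -> T) (t : R) : T :=
  if s.1 then h t (side_sign s) else h (side_sign s) t.

Definition position E (t : R) : vec2 R :=
  on_side E.2 (fun x y =>
    mk_vec2 (eval2 (map_x M E.1) x y) (eval2 (map_y M E.1) x y)) t.

(* Metric-scaled outward normal J G^{-T} n^. *)
Definition normal E (t : R) : vec2 R :=
  on_side E.2 (fun x y =>
    jac E.1 x y *: ((invmx (jacobian_mx E.1 x y))^T *m ref_normal E.2)) t.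

Definition unit_normal E (t : R) : vec2 R :=
  (enorm (normal E t))^-1 *: normal E t.

(* The translation by the lattice vector with integer coordinates [z]. *)
Definition shift (z : 'cV[int]_2) : vec2 R := period M *m map_mx intr z.

Variables (N : nat) (xi : 'I_N.+1 -> R).

(* The Jacobian is positive on the closed reference square: the element maps
   are orientation preserving, as "outward" in [normal] requires. *)
Definition isoparametric : Prop :=
  forall e, [/\ in_QN N (map_x M e), in_QN N (map_y M e) &
    forall x y : R, -1 <= x <= 1 -> -1 <= y <= 1 -> 0 < jac e x y].

Definition conforming_edges : Prop :=
  forall E E' r, connect_edge M E = Conforming E' r ->
    [/\ E' != E, connect_edge M E' = Conforming E r,
        exists z, forall i,
          position E' (xi (flip_node r i)) = position E (xi i) + shift z &
        forall i, normal E' (xi (flip_node r i)) = - normal E (xi i)].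

(* Nonconforming interfaces: the fine edges cover the two halves of the coarse
   edge, and unit normals are opposite at the same physical point. *)
Definition fine_coarse_matching (F C : edge Ne) (k : 'I_2) (r : bool) : Prop :=
  exists z, forall t : R, -1 <= t <= 1 ->
    position F (flip_coord r t) = position C (half k t) + shift z /\
    unit_normal F (flip_coord r t) = - unit_normal C (half k t).

Definition nonconforming_edges : Prop :=
  (forall C f r, connect_edge M C = CoarseOf f r -> forall k,
     connect_edge M (f k) = FineOf k C (r k) /\
     fine_coarse_matching (f k) C k (r k)) /\
  (forall F k C rF, connect_edge M F = FineOf k C rF ->
     exists f r, [/\ connect_edge M C = CoarseOf f r, f k = F & r k = rF]).

Definition valid_mesh : Prop :=
  [/\ isoparametric, conforming_edges & nonconforming_edges].

End Geometry.

Section Scheme.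
Variables (R : realType) (N Ne : nat) (xi : 'I_N.+1 -> R) (M : mesh R Ne).
Variables (fsharp gsharp : state R -> state R -> state R).
(* [alpha E i] is the wave-speed estimate at node [i] of edge [E] and [U] the
   array of nodal states, both at a fixed time.  On a nonconforming interface
   only the estimates on the fine edges are used. *)
Variables (alpha : edge Ne -> 'I_N.+1 -> R).
Variables (U : 'I_Ne -> 'I_N.+1 -> 'I_N.+1 -> state R).
Implicit Types (e : 'I_Ne) (s : side) (E F C : edge Ne) (i j m n : 'I_N.+1).

Let w := weight xi.
Let D := diffmx xi.

Definition mean (a b : R) : R := (a + b) / 2%:R.

Definition ftilde_sharp e i m j : state R :=
  mean (y_eta M e (xi i) (xi j)) (y_eta M e (xi m) (xi j))
    *: fsharp (U e i j) (U e m j)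
  - mean (x_eta M e (xi i) (xi j)) (x_eta M e (xi m) (xi j))
    *: gsharp (U e i j) (U e m j).

Definition gtilde_sharp e i j n : state R :=
  - mean (y_xi M e (xi i) (xi j)) (y_xi M e (xi i) (xi n))
    *: fsharp (U e i j) (U e i n)
  + mean (x_xi M e (xi i) (xi j)) (x_xi M e (xi i) (xi n))
    *: gsharp (U e i j) (U e i n).

Definition ftilde e i j : state R :=
  y_eta M e (xi i) (xi j) *: flux_f (U e i j)
  - x_eta M e (xi i) (xi j) *: flux_g (U e i j).

Definition gtilde e i j : state R :=
  - y_xi M e (xi i) (xi j) *: flux_f (U e i j)
  + x_xi M e (xi i) (xi j) *: flux_g (U e i j).

Definition trace E i : state R :=
  let b : 'I_N.+1 := if E.2.2 then ord_max else ord0 in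
  if E.2.1 then U E.1 i b else U E.1 b i.

Definition node_normal E i : vec2 R := normal M E (xi i).

(* Outward numerical normal flux at node [i] of [E], whose neighbour is [E']. *)
Definition conforming_flux E E' (r : bool) i : state R :=
  llf_flux (alpha E i) (trace E i) (trace E' (flip_node r i)) (node_normal E i).

(* In the next two definitions [i] numbers the fine nodes along the coarse edge
   coordinate; the node number within the fine element is [flip_node r i]. *)
Definition nc_normal F (r : bool) C i j : vec2 R :=
  2%:R^-1 *: (node_normal F (flip_node r i) - 2%:R^-1 *: node_normal C j).

(* The sign-modified two-point flux, in the direction from fine to coarse. *)
Definition nc_flux (k : 'I_2) F (r : bool) C i j : state R :=
  let l := flip_node r i in
  let nFC := nc_normal F r C i j in
  2%:R^-1 *: (normal_flux (trace F l) nFC + normal_flux (trace C j) nFC)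
  - (Num.sg (P_CF xi k i j) * (alpha F l * enorm (node_normal F l) / 2%:R))
    *: (trace C j - trace F l).

(* Numerical flux in the direction of the outward metric-scaled normal, at node
   [l] of edge [E]. *)
Definition numerical_flux E l : state R :=
  match connect_edge M E with
  | Conforming E' r => conforming_flux E E' r l
  | FineOf k C r => let i := flip_node r l in
      \sum_(j < N.+1) P_CF xi k i j *: nc_flux k E r C i j
  | CoarseOf f r =>
      - 2%:R *: \sum_(k < 2) \sum_(i < N.+1)
                  P_FC xi k l i *: nc_flux k (f k) (r k) E i l
  end.

(* The component of (f~*, g~* ) along the coordinate axis normal to side [s]:
   the reference normal of [s] is [side_sign s] times that axis, and
   [side_sign s] is its own inverse. *)
Definition interface_flux e s l : state R :=
  side_sign R s *: numerical_flux (e, s) l.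

Definition delta_f e i j (b : bool) : state R :=
  ftilde e i j - interface_flux e (false, b) j.
Definition delta_g e i j (b : bool) : state R :=
  gtilde e i j - interface_flux e (true, b) i.

(* Left-hand side of the scheme; [dU] stands for the time derivative of [U]. *)
Definition dgsem_residual (dU : 'I_Ne -> 'I_N.+1 -> 'I_N.+1 -> state R)
    e i j : state R :=
  (w i * w j) *:
    (jac M e (xi i) (xi j) *: dU e i j
     + 2%:R *: \sum_(m < N.+1) D i m *: ftilde_sharp e i m j
     + 2%:R *: \sum_(n < N.+1) D j n *: gtilde_sharp e i j n)
  + w i *: ((j == ord0)%:R *: delta_g e i ord0 false
            - (j == ord_max)%:R *: delta_g e i ord_max true)
  + w j *: ((i == ord0)%:R *: delta_f e ord0 j false
            - (i == ord_max)%:R *: delta_f e ord_max j true).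

(* Both sides of a conforming edge use the same wave-speed estimate. *)
Definition wave_speed_two_sided : Prop :=
  forall E E' r, connect_edge M E = Conforming E' r ->
    forall i, alpha E' (flip_node r i) = alpha E i.

Definition conforming_entropy_stable : Prop :=
  forall E E' r, connect_edge M E = Conforming E' r -> forall i,
    let UL := trace E i in
    let UR := trace E' (flip_node r i) in
    dot_state (entropy_vars UR - entropy_vars UL) (conforming_flux E E' r i)
    - dot2 (potential UR - potential UL) (node_normal E i) <= 0.

(* Oriented as in the conforming case: [nc_normal] points from the fine to the
   coarse element, so the jump is the coarse value minus the fine value. *)
Definition nonconforming_entropy_stable : Prop :=
  forall C f r, connect_edge M C = CoarseOf f r ->
  forall (k : 'I_2) (i j : 'I_N.+1),
    let UF := trace (f k) (flip_node (r k) i) in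
    let UC := trace C j in
    P_CF xi k i j *
      (dot_state (entropy_vars UC - entropy_vars UF)
                 (nc_flux k (f k) (r k) C i j)
       - dot2 (potential UC - potential UF)
              (nc_normal (f k) (r k) C i j)) <= 0.

End Scheme.

(* Main.v *)
(** Testing the scheme against nodal values W(U) turns the volume terms into
    boundary terms: the LGL quadrature is exact up to degree 2N-1, so w D is a
    summation-by-parts operator, and the only other contribution is the discrete
    metric identity, which holds because the element maps have degree <= N in
    each variable.  What is left is, for every edge, the sum of
    w (W . F* - psi . n).  The choice W = V, with psi the entropy potential,
    gives the entropy balance; W = +v and W = -v with v constant and psi = 0
    give conservation, so a single sign statement about the edge sums yields
    both conclusions.  On a conforming edge the two sides add up to minus the
    quantity in (i).  On a nonconforming interface they add up to minus the
    weighted sum of the quantities in (ii), provided the terms psi . n cancel;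
    they do because fine normals are -1/2 times the coarse normal at the same
    point and the quadrature on the two halves is exact for the degree 2N-1
    polynomials phi_j n^C. *)
Require Import Defs.
From HB Require Import structures.
From mathcomp Require Import all_boot all_order all_algebra.
From mathcomp Require Import all_classical all_reals all_analysis.
From mathcomp Require Import ring lra zify.
Import Order.TTheory GRing.Theory Num.Theory.
Import numFieldNormedType.Exports.
Local Open Scope ring_scope.

Set Implicit Arguments.
Unset Strict Implicit.
Unset Printing Implicit Defensive.

(** * Integrals of polynomials *)

Lemma poly_eq_itv (R : realType) (a b : R) (p q : {poly R}) : a < b ->
  (forall x, a <= x <= b -> p.[x] = q.[x]) -> p = q.
Proof.
move=> ab pq; apply/eqP; rewrite -subr_eq0; apply/eqP.
pose n := size (p - q).
(* Distinct points of the interval, as many as the size of [p - q]: more than a nonzero polynomial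
   can have as roots. *)
pose s := [seq a + (b - a) / i.+1%:R | i <- iota 0 n].
apply: (@roots_geq_poly_eq0 _ _ s).
- apply/allP => x /mapP[i _ ->].
  rewrite rootE hornerD hornerN pq ?subrr//.
  have i0 : 0 < i.+1%:R :> R by [].
  rewrite lerDl divr_ge0 ?subr_ge0 ?(ltW ab)//=.
  rewrite -lerBrDl ler_pdivrMr// ler_peMr ?subr_ge0 ?(ltW ab)//.
  by rewrite ler1n.
- rewrite map_inj_uniq ?iota_uniq// => i j /addrI/mulfI.
  rewrite subr_eq0 gt_eqF// => /(_ isT) /invr_inj /eqP.
  by rewrite eqr_nat eqSS => /eqP.
- by rewrite size_map size_iota.
Qed.

Section PolyIntegral.
Variable R : realType.
Implicit Types (p q F : {poly R}) (a b c d x : R).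

(* The coefficient of index 0 is p`_0 / 0 = 0. *)
Definition prim p : {poly R} := \poly_(i < (size p).+1) (p`_i.-1 / i%:R).

Lemma deriv_prim p : (prim p)^`() = p.
Proof.
apply/polyP => i; rewrite coef_deriv coef_poly ltnS /=.
case: ltnP => ip; last by rewrite mul0rn nth_default.
by rewrite -[LHS]mulr_natr mulfVK// pnatr_eq0.
Qed.

Lemma deriv_eq0 p : p^`() = 0 -> p = (p`_0)%:P.
Proof.
move=> p0; apply/polyP => -[|i]; rewrite coefC//=.
have /eqP := congr1 (fun q : {poly R} => q`_i) p0.
by rewrite coef_deriv coef0 mulrn_eq0 /= => /eqP.
Qed.

(** The integral as a difference of values of an antiderivative, so that the rules of integration
    are pure algebra. [Rintegral_poly] identifies it with the Lebesgue integral in [weight]. *)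
Definition pint p a b : R := (prim p).[b] - (prim p).[a].

(** [F] and the chosen antiderivative of its derivative differ by a constant, which cancels in the
    difference. *)
Lemma pint_deriv F a b : pint F^`() a b = F.[b] - F.[a].
Proof.
rewrite /pint; have /deriv_eq0 : (prim F^`() - F)^`() = 0.
  by rewrite derivB deriv_prim subrr.
move/(congr1 (fun q => q.[b] - q.[a])); rewrite !hornerE => h.
apply/eqP; rewrite -subr_eq0; apply/eqP; rewrite -[RHS](subrr ((prim F^`() - F)`_0)) -h.
by ring.
Qed.

Lemma pintD p q a b : pint (p + q) a b = pint p a b + pint q a b.
Proof.
rewrite -{1}(deriv_prim p) -{1}(deriv_prim q) -derivD pint_deriv !hornerD.
by rewrite /pint; ring.
Qed.

Lemma pintZ k p a b : pint (k *: p) a b = k * pint p a b.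
Proof.
by rewrite -{1}(deriv_prim p) -derivZ pint_deriv !hornerZ /pint; ring.
Qed.

Lemma pint_sum I (r : seq I) (P : pred I) (f : I -> {poly R}) a b :
  pint (\sum_(i <- r | P i) f i) a b = \sum_(i <- r | P i) pint (f i) a b.
Proof.
elim/big_rec2: _ => [|i x y _ <-]; last exact: pintD.
by rewrite -(scale0r 0) pintZ mul0r.
Qed.

Lemma pint_parts p q a b : pint (p^`() * q) a b =
  (p * q).[b] - (p * q).[a] - pint (p * q^`()) a b.
Proof. by rewrite -pint_deriv derivM pintD addrK. Qed.

Lemma pint_cat p a b c : pint p a b + pint p b c = pint p a c.
Proof. by rewrite /pint; ring. Qed.

Lemma pint_comp_affine p c d a b :
  c * pint (p \Po (c *: 'X + d%:P)) a b = pint p (c * a + d) (c * b + d).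
Proof.
rewrite -{1}(deriv_prim p) -pintZ.
have -> : c *: ((prim p)^`() \Po (c *: 'X + d%:P)) =
    (prim p \Po (c *: 'X + d%:P))^`().
  by rewrite deriv_comp derivD derivZ derivX derivC addr0 alg_polyC
             mulrC mul_polyC.
by rewrite pint_deriv !horner_comp !hornerE.
Qed.

(** The antiderivative is nondecreasing; equal values at the two ends would make it constant on the
    interval, hence constant as a polynomial, and [p] would be zero. *)
Lemma pint_gt0 p a b : a < b -> (forall x, a <= x <= b -> 0 <= p.[x]) ->
  p != 0 -> 0 < pint p a b.
Proof.
move=> ab p_ge0 p_neq0.
have mono x y : a <= x -> x <= y -> y <= b -> (prim p).[x] <= (prim p).[y].
  move=> ax xy yb.
  have df z : z \in `]a, b[ -> derivable (horner (prim p)) z 1.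
    by move=> _; exact: derivable_horner.
  have df_ge0 z : z \in `]a, b[ -> 0 <= (horner (prim p))^`()%classic z.
    rewrite in_itv/= => /andP[az zb].
    by rewrite -derivE deriv_prim p_ge0// !ltW.
  apply: (ger0_derive1_le_cc df df_ge0) => //.
  - by apply: continuous_subspaceT => z; exact: continuous_horner.
  - by rewrite in_itv/= ax (le_trans xy).
  - by rewrite in_itv/= yb (le_trans ax).
rewrite /pint subr_gt0 lt_neqAle mono ?(ltW ab)// andbT.
apply: contra p_neq0 => /eqP eab.
rewrite -(deriv_prim p) (_ : prim p = ((prim p).[a])%:P) ?derivC//.
apply: (poly_eq_itv ab) => x /andP[ax xb]; rewrite hornerC.
by apply/le_anti; rewrite {1}eab !mono.
Qed.

Lemma Rintegral_poly p a b : a < b ->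
  (\int[@lebesgue_measure R]_(x in `[a, b]) p.[x])%R = pint p a b.
Proof.
move=> ab; rewrite /Rintegral (@continuous_FTC2 _ _ (horner (prim p)))//.
- by apply: continuous_subspaceT => z; exact: continuous_horner.
- split.
  + by move=> z _; exact: derivable_horner.
  + by apply: cvg_at_right_filter; exact: continuous_horner.
  + by apply: cvg_at_left_filter; exact: continuous_horner.
- by move=> z _; rewrite -derivE deriv_prim.
Qed.

End PolyIntegral.

(** * Legendre polynomials and LGL quadrature *)

Lemma size_deriv_le (A : nzRingType) (p : {poly A}) n :
  (size p <= n)%N -> (size p^`() <= n.-1)%N.
Proof.
have [->|p0] := eqVneq p 0; first by rewrite deriv0 size_poly0.
by move=> pn; have := lt_size_deriv p0; lia.
Qed.

Section Legendre.
Variables (R : realType) (N : nat).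
Implicit Types (p s : {poly R}) (x y : R).
Local Notation u := (('X ^+ 2 - 1) ^+ N : {poly R}).
Local Notation L := (legendre R N).

Lemma size_deriv p : size p^`() = (size p).-1.
Proof.
have [->|p0] := eqVneq p 0; first by rewrite deriv0 size_poly0.
apply/eqP; rewrite eqn_leq size_deriv_le//=; case: ltnP => // h.
case E : (size p) h => [|[|n]]//= /leq_sizeP /(_ n (leqnn _)) /eqP.
rewrite coef_deriv mulrn_eq0/= => pn.
by move: p0; rewrite -lead_coef_eq0 /lead_coef E pn.
Qed.

Lemma coef_exp_ge0 p n : (forall i, 0 <= p`_i) -> forall i, 0 <= (p ^+ n)`_i.
Proof.
move=> p_ge0; elim: n => [|n IH] i; first by rewrite expr0 coef1 ler0n.
by rewrite exprS coefM sumr_ge0// => j _; rewrite mulr_ge0.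
Qed.

Lemma horner_gt0 p x : (forall i, 0 <= p`_i) -> p != 0 -> 0 < x -> 0 < p.[x].
Proof.
move=> p_ge0 p0 x0; rewrite lt_neqAle horner_coef.
have ge0 (i : 'I_(size p)) : true -> 0 <= p`_i * x ^+ i.
  by move=> _; rewrite mulr_ge0 ?exprn_ge0 ?(ltW x0).
rewrite sumr_ge0// andbT eq_sym; apply/negP => /eqP /(psumr_eq0P ge0) h.
have s0 : (0 < size p)%N by rewrite size_poly_gt0.
have s1 : ((size p).-1 < size p)%N by rewrite prednK.
have /eqP := h (Ordinal s1) isT.
rewrite mulf_eq0 expf_eq0 (gt_eqF x0) andbF orbF/= -/(lead_coef p).
by rewrite lead_coef_eq0 (negPf p0).
Qed.

Lemma size_legendre : size L = N.+1.
Proof.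
have su : size u = (2 * N).+1.
  have u0 : u != 0 by rewrite expf_neq0// -size_poly_gt0 size_XnsubC.
  have := size_exp ('X^2 - 1 : {poly R}) N.
  rewrite (@size_XnsubC _ 2)//= => <-.
  by rewrite prednK// size_poly_gt0.
have N0 : ((2 ^ N * N`!)%:R : R) != 0.
  by rewrite pnatr_eq0 muln_eq0 expn_eq0/= -lt0n fact_gt0.
rewrite /legendre size_scale ?invr_eq0//; apply/eqP; rewrite eqn_leq.
apply/andP; split.
  apply/leq_sizeP => j Nj; rewrite coef_derivn nth_default ?mul0rn// su; lia.
(* Coefficient N of the N-th derivative is a positive multiple of coefficient 2N of [u], which is
   its leading one. *)
rewrite ltnNge; apply/negP => /leq_sizeP /(_ _ (leqnn _)) /eqP.
rewrite coef_derivn mulrn_eq0 -leqn0 leqNgt ffact_gt0 leq_addr/=.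
have -> : (N + N)%N = (size u).-1 by rewrite su; lia.
by rewrite -/(lead_coef u) lead_coef_eq0 -size_poly_eq0 su.
Qed.

Lemma derivn_comp_affine p (c d : R) n :
  (p \Po (c *: 'X + d%:P))^`(n) = c ^+ n *: (p^`(n) \Po (c *: 'X + d%:P)).
Proof.
elim: n => [|n IH]; first by rewrite expr0 scale1r.
rewrite derivnS IH derivZ deriv_comp derivD derivZ derivX derivC addr0.
by rewrite alg_polyC mulrC mul_polyC scalerA exprSr derivnS.
Qed.

(** In the Rodrigues formula [u] is even, and each of the N derivatives contributes one factor
    -1. *)
Lemma legendre_comp_opp : L \Po - 'X = (-1) ^+ N *: L.
Proof.
have e : - 'X = (-1) *: 'X + 0%:P :> {poly R} by rewrite addr0 scaleN1r.
have eu : u \Po - 'X = u.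
  by rewrite rmorphXn/= rmorphB/= rmorphXn/= comp_polyX rmorph1 sqrrN.
rewrite /legendre comp_polyZ scalerA mulrC -scalerA; congr (_ *: _).
rewrite -[in RHS]eu e derivn_comp_affine scalerA -exprMn mulrNN mulr1 expr1n.
by rewrite scale1r.
Qed.

Lemma deriv_parity p c x : p \Po - 'X = c *: p ->
  p^`().[- x] = - c * p^`().[x].
Proof.
move/(congr1 (fun q => (q^`()).[x])).
rewrite deriv_comp derivZ derivN derivX hornerZ hornerM horner_comp !hornerE.
by move=> h; rewrite mulNr -h mulrN1 opprK.
Qed.

Lemma deriv_legendreN x : L^`().[- x] = - (-1) ^+ N * L^`().[x].
Proof. exact/deriv_parity/legendre_comp_opp. Qed.

(* In powers of X - 1 the polynomial X^2 - 1 = (X - 1) (X - 1 + 2) has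
   nonnegative coefficients, hence so do the derivatives of its powers. *)
Lemma deriv_legendre_gt1 x : (0 < N)%N -> 1 < x -> L^`().[x] != 0.
Proof.
move=> N0 x1.
pose a : {poly R} := 1 *: 'X + 1%:P.
have -> : L^`().[x] = (L^`() \Po a).[x - 1].
  by rewrite horner_comp !hornerE subrK.
have -> : L^`() \Po a = ((2 ^ N * N`!)%:R)^-1 *: (u \Po a)^`(N.+1).
  by rewrite derivn_comp_affine expr1n scale1r /legendre derivZ comp_polyZ -derivnS.
have eu : u \Po a = ('X * ('X + 2%:R%:P)) ^+ N.
  rewrite rmorphXn/= rmorphB/= rmorphXn/= comp_polyX rmorph1 /a; congr (_ ^+ _).
  rewrite scale1r polyC1 polyC_natr; ring.
rewrite eu; set q := (_ * _) ^+ N.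
have qge0 i : 0 <= (q^`(N.+1))`_i.
  rewrite coef_derivn mulrn_wge0//; apply: coef_exp_ge0 => {}i.
  rewrite mulrDr coefD -expr2 coefXn coefMC coefX.
  by rewrite addr_ge0 ?mulr_ge0 ?ler0n.
rewrite hornerZ; apply: mulf_neq0.
  by rewrite invr_eq0 pnatr_eq0 muln_eq0 expn_eq0/= -lt0n fact_gt0.
(* Composition with [a], of degree one, preserves the size, and [L] has size N + 1 with N positive,
   so its derivative is nonzero. *)
have q0 : q^`(N.+1) != 0.
  rewrite /q -eu derivn_comp_affine expr1n scale1r.
  have sa : size a = 2 by rewrite /a scale1r size_XaddC.
  rewrite -size_poly_gt0 size_comp_poly2// size_poly_gt0 derivnS.
  have : L^`() != 0 by rewrite -size_poly_gt0 size_deriv size_legendre.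
  by rewrite /legendre derivZ; apply: contra => /eqP ->; rewrite scaler0.
by rewrite gt_eqF// horner_gt0 ?subr_gt0.
Qed.

(** No root lies above 1, and parity carries a root below -1 to one above 1. *)
Lemma root_deriv_legendre x : (0 < N)%N -> root L^`() x -> -1 <= x <= 1.
Proof.
rewrite rootE => N0 x0; rewrite !leNgt; apply/andP; split; apply/negP => h.
  have x1 : 1 < - x by lra.
  by have := deriv_legendre_gt1 N0 x1; rewrite deriv_legendreN (eqP x0) mulr0 eqxx.
by move: x0; apply/negP/deriv_legendre_gt1.
Qed.

(** Each derivative costs at most one factor [p], so derivatives of order below [n] still vanish at
    the roots of [p]. *)
Lemma derivn_exp (p : {poly R}) n k : (k <= n)%N ->
  exists g, (p ^+ n)^`(k) = g * p ^+ (n - k).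
Proof.
elim: k => [|k IH] kn; first by exists 1; rewrite mul1r subn0.
have [|g gE] := IH; first exact: ltnW.
exists (g^`() * p + g * p^`() *+ (n - k)).
rewrite derivnS gE derivM deriv_exp.
have -> : (n - k = (n - k.+1).+1)%N by lia.
by rewrite /= exprS; ring.
Qed.

Lemma legendre_orth s : (size s <= N)%N -> pint (L * s) (-1) 1 = 0.
Proof.
(* Integration by parts [k] times. The boundary terms contain a factor X^2 - 1, as the order stays
   below N, and each step lowers the size of [s'], which ends as the zero polynomial. *)
have main k s' : (k <= N)%N -> (size s' <= k)%N -> pint (u^`(k) * s') (-1) 1 = 0.
  elim: k s' => [|k IH] s' kN.
    by rewrite size_poly_leq0 => /eqP ->; rewrite mulr0 -(scale0r 0) pintZ mul0r.
  move=> ss; rewrite derivnS pint_parts IH ?(ltnW kN)//; last exact: size_deriv_le ss.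
  have [g ->] := derivn_exp ('X ^+ 2 - 1) (ltnW kN).
  have -> : (N - k = (N - k).-1.+1)%N by lia.
  have z x : x ^+ 2 = 1 -> ('X ^+ 2 - 1 : {poly R}).[x] = 0.
    by move=> x2; rewrite !hornerE x2 subrr.
  rewrite exprS !hornerM !z ?expr1n ?sqrrN ?expr1n//.
  by rewrite !(mul0r, mulr0, subrr).
by move=> sN; rewrite /legendre -scalerAl pintZ main ?mulr0.
Qed.

End Legendre.

(** * Lagrange interpolation at distinct nodes *)

Section LagrangeBasis.
Variables (R : realType) (N : nat) (xi : 'I_N.+1 -> R).
Hypothesis xi_inj : injective xi.
Implicit Types (p q : {poly R}) (i j : 'I_N.+1).
Local Notation phi := (lagrange_basis xi).

Lemma size_lagrange i : (size (phi i) <= N.+1)%N.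
Proof.
rewrite /lagrange_basis; apply: leq_trans (size_prod_leq _ _) _.
have h j : (size ((xi i - xi j)^-1 *: ('X - (xi j)%:P)) <= 2)%N.
  by apply: leq_trans (size_scale_leq _ _) _; rewrite size_XsubC.
have c : #|(fun j => j != i)| = N by have := cardC1 i; rewrite card_ord.
have : (\sum_(j | j != i) size ((xi i - xi j)^-1 *: ('X - (xi j)%:P)) <=
    \sum_(j : 'I_N.+1 | j != i) 2)%N.
  by apply: leq_sum => j _.
by rewrite sum_nat_const c; move: (\sum_(j | _) _)%N => S; lia.
Qed.

Lemma lagrange_node i j : (phi i).[xi j] = (i == j)%:R.
Proof.
rewrite /lagrange_basis horner_prod; case: eqVneq => [<-|ij].
  rewrite big1// => k ki; rewrite !hornerE mulVf// subr_eq0.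
  by rewrite (inj_eq xi_inj) eq_sym.
rewrite (bigD1 j) 1?eq_sym//= !hornerE subrr mulr0 mul0r//.
Qed.

Lemma eq_on_nodes p q : (size p <= N.+1)%N -> (size q <= N.+1)%N ->
  (forall i, p.[xi i] = q.[xi i]) -> p = q.
Proof.
move=> sp sq pq; apply/eqP; rewrite -subr_eq0; apply/eqP.
apply: (@roots_geq_poly_eq0 _ _ (codom xi)).
- by apply/allP => _ /codomP[i ->]; rewrite rootE hornerD hornerN pq subrr.
- exact/injectiveP.
- rewrite size_codom card_ord; apply: leq_trans (size_polyD _ _) _.
  by rewrite size_polyN geq_max sp.
Qed.

Lemma sum_delta (A : lmodType R) (f : 'I_N.+1 -> A) i :
  \sum_j (j == i)%:R *: f j = f i.
Proof.
rewrite (bigD1 i)//= eqxx scale1r big1 ?addr0// => j /negPf ->.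
by rewrite scale0r.
Qed.

Lemma lagrange_interpolation p : (size p <= N.+1)%N ->
  p = \sum_j p.[xi j] *: phi j.
Proof.
move=> sp; apply: eq_on_nodes => // [|i].
  apply: leq_trans (size_sum _ _ _) _; apply/bigmax_leqP => j _.
  exact: leq_trans (size_scale_leq _ _) (size_lagrange j).
rewrite horner_sum -(sum_delta (fun j => p.[xi j]) i).
by apply: eq_bigr => j _; rewrite hornerZ lagrange_node mulrC.
Qed.

Lemma diffmx_exact p i : (size p <= N.+1)%N ->
  \sum_j Defs.diffmx xi i j * p.[xi j] = p^`().[xi i].
Proof.
move=> sp; rewrite [in RHS](lagrange_interpolation sp) raddf_sum horner_sum.
by apply: eq_bigr => j _; rewrite mxE /= derivZ hornerZ mulrC.
Qed.

Lemma P_CF_exact p k i : (size p <= N.+1)%N ->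
  \sum_j P_CF xi k i j * p.[xi j] = p.[Defs.half k (xi i)].
Proof.
move=> sp; rewrite [in RHS](lagrange_interpolation sp) horner_sum.
by apply: eq_bigr => j _; rewrite mxE hornerZ mulrC.
Qed.

Lemma weightE i : weight xi i = pint (phi i) (-1) 1.
Proof. by apply: Rintegral_poly; lra. Qed.

End LagrangeBasis.

(** * LGL nodes, weights, exactness and summation by parts *)

Section LGL.
Variables (R : realType) (N : nat) (xi : 'I_N.+1 -> R).
Hypotheses (N_gt0 : (0 < N)%N) (xi_LGL : LGL_nodes xi).
Implicit Types (p : {poly R}) (i j : 'I_N.+1).
Local Notation phi := (lagrange_basis xi).
Local Notation L := (legendre R N).
Local Notation q := ((1 - 'X ^+ 2) * deriv L : {poly R}).
Local Notation w := (weight xi).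

Lemma LGL_inj : injective xi.
Proof.
move=> i j xij; apply: val_inj.
by case: (ltngtP i j) => // /(proj1 xi_LGL); rewrite xij ltxx.
Qed.

Lemma size_1subX2 : size (1 - 'X ^+ 2 : {poly R}) = 3.
Proof. by rewrite -size_polyN opprB size_XnsubC. Qed.

Lemma size_LGL : size q = N.+2.
Proof.
have sL : size (L^`()) = N by rewrite size_deriv size_legendre.
by rewrite size_mul -?size_poly_gt0 ?size_1subX2 ?sL.
Qed.

(** The nodes are already N + 1 distinct roots of a polynomial of degree N + 1; one more root would
    be too many. *)
Lemma LGL_root x : root q x -> exists i, xi i = x.
Proof.
move=> qx; have [/codomP[i ->]|xN] := boolP (x \in codom xi); first by exists i.
have q0 : q != 0 by rewrite -size_poly_gt0 size_LGL.
have := @max_poly_roots _ q (x :: codom xi) q0.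
rewrite size_LGL /= size_codom card_ord ltnn qx xN/= => h; suff: false by []; apply: h.
  by apply/allP => _ /codomP[i ->]; exact: (proj2 xi_LGL).
exact/injectiveP/LGL_inj.
Qed.

Lemma LGL_bounds i : -1 <= xi i <= 1.
Proof.
have := proj2 xi_LGL i; rewrite rootM => /orP[|/(root_deriv_legendre N_gt0)//].
rewrite rootE !hornerE subr_eq0 eq_sym sqrf_eq1 => /orP[] /eqP ->; lra.
Qed.

Lemma LGL_le i j : (i <= j)%N -> xi i <= xi j.
Proof.
rewrite leq_eqVlt => /predU1P[/val_inj -> //|/(proj1 xi_LGL)/ltW//].
Qed.

(** -1 is a root, hence a node, and no node lies below it; the increasing order makes it the first
    one. *)
Lemma LGL_ord0 : xi ord0 = -1.
Proof.
have [|i xiE] := @LGL_root (-1).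
  by rewrite rootM rootE !hornerE sqrrN expr1n subrr eqxx.
by apply/le_anti; rewrite -{1}xiE LGL_le// (andP (LGL_bounds _)).1.
Qed.

Lemma LGL_ord_max : xi ord_max = 1.
Proof.
have [|i xiE] := @LGL_root 1.
  by rewrite rootM rootE !hornerE expr1n subrr eqxx.
by apply/le_anti; rewrite -{2}xiE LGL_le ?leq_ord// (andP (LGL_bounds _)).2.
Qed.

Lemma sorted_codom (f : 'I_N.+1 -> R) : {homo f : i j / (i < j)%N >-> i < j} ->
  sorted <%R (codom f).
Proof.
move=> f_homo; rewrite /codom /image_mem sorted_map.
apply: (@sub_sorted _ (relpre val ltn)); first by move=> i j; exact: f_homo.
by rewrite -sorted_map val_enum_ord iota_ltn_sorted.
Qed.

(** By parity the set of roots is stable under negation, and two increasing enumerations of the same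
    set coincide. *)
Lemma LGL_symmetric i : xi (rev_ord i) = - xi i.
Proof.
have homoN : {homo (fun i => - xi (rev_ord i)) : i j / (i < j)%N >-> i < j}.
  move=> a b ab; rewrite ltrN2; apply: (proj1 xi_LGL) => /=.
  by have := ltn_ord b; lia.
have eqc : codom xi = codom (fun i => - xi (rev_ord i)).
  apply: lt_sorted_eq; [exact/sorted_codom/(proj1 xi_LGL)|exact: sorted_codom|].
  have rN x : root q x -> root q (- x).
    rewrite !rootM !rootE !hornerE deriv_legendreN sqrrN !mulf_eq0.
    by move=> /orP[->//|->]; rewrite !orbT.
  move=> x; apply/codomP/codomP => -[j ->].
    have [k xk] := LGL_root (rN _ (proj2 xi_LGL j)).
    by exists (rev_ord k); rewrite rev_ordK xk opprK.
  by have [k xk] := LGL_root (rN _ (proj2 xi_LGL (rev_ord j))); exists k.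
have := congr1 (fun s => nth 0 s (enum_rank (rev_ord i))) eqc.
by rewrite !nth_codom enum_rankK rev_ordK.
Qed.

Lemma flip_nodeE r i : xi (flip_node r i) = flip_coord r (xi i).
Proof. by case: r => //=; exact: LGL_symmetric. Qed.

(* Division by (1 - X^2) L' leaves a polynomial of degree <= N; integration by
   parts moves the quotient onto L, which is orthogonal to lower degrees. *)
Lemma LGL_exact p : (size p <= 2 * N)%N ->
  pint p (-1) 1 = \sum_i w i * p.[xi i].
Proof.
move=> sp; have q0 : q != 0 by rewrite -size_poly_gt0 size_LGL.
have e : pint p (-1) 1 = pint (p %% q) (-1) 1.
  rewrite {1}(divp_eq p q) pintD; suff -> : pint (p %/ q * q) (-1) 1 = 0 by rewrite add0r.
  set s := p %/ q.
  have ss : (size s <= N.-1)%N.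
    by rewrite /s size_divp// size_LGL /=; move: (size p) sp => a; lia.
  have -> : s * q = L^`() * (s * (1 - 'X ^+ 2)) by rewrite [(1 - _) * _]mulrC mulrCA.
  rewrite pint_parts legendre_orth; last first.
    apply: leq_trans (size_deriv_le (leqnn _)) _.
    have := size_polyMleq s (1 - 'X ^+ 2); rewrite size_1subX2.
    by move: (size _) (size s) ss N_gt0 => a b; lia.
  have z x : x ^+ 2 = 1 -> (1 - 'X ^+ 2 : {poly R}).[x] = 0.
    by move=> x2; rewrite !hornerE x2 subrr.
  by rewrite !hornerM !z ?sqrrN ?expr1n// !mulr0 !subrr.
(* The remainder has degree at most N, so it equals its interpolant; it agrees with [p] at the nodes
   because they are roots of [q]. *)
rewrite e [in LHS](lagrange_interpolation LGL_inj (p := p %% q)); last first.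
  by have := ltn_modp p q; rewrite q0 size_LGL ltnS.
rewrite pint_sum; apply: eq_bigr => i _; rewrite pintZ weightE mulrC.
congr (_ * _); rewrite [in RHS](divp_eq p q) hornerD hornerM.
by rewrite (eqP (proj2 xi_LGL i)) mulr0 add0r.
Qed.

(** Reversing the index composes the basis polynomial with negation, and the substitution rule with
    slope -1 leaves the integral over [-1,1] unchanged. *)
Lemma weight_rev i : w (rev_ord i) = w i.
Proof.
have e : phi (rev_ord i) = phi i \Po (-1 *: 'X + 0%:P).
  apply: (eq_on_nodes LGL_inj) (size_lagrange _ _) _ _ => [|j].
    rewrite size_comp_poly2 ?size_lagrange// addr0 scaleN1r size_polyN size_polyX//.
  rewrite horner_comp !hornerE mulN1r -LGL_symmetric !(lagrange_node LGL_inj).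
  by rewrite -[in RHS](inj_eq rev_ord_inj) rev_ordK.
rewrite !weightE e -[LHS]opprK -[X in - X]mulN1r pint_comp_affine.
by rewrite !addr0 mulrNN !mulr1 /pint opprB.
Qed.

Lemma weight_flip r i : w (flip_node r i) = w i.
Proof. by case: r => //=; exact: weight_rev. Qed.

(* For i != 0 the node -1 is a root of phi_i = (1 + X) g, so phi_i g has degree
   2N-1, and w_i g(xi_i) is the integral of (1 + X) g^2. *)
Lemma weight_gt0 i : 0 < w i.
Proof.
(* The first weight equals the last one by symmetry, and the last index is not 0 since N is
   positive. *)
wlog i0 : i / i != ord0 => [th|].
  have [->|] := eqVneq i ord0; last exact: th.
  by rewrite -weight_rev th// -val_eqE/= subn1 -lt0n.
have xi_gt : 0 < 1 + xi i.
  have := proj1 xi_LGL ord0 i; rewrite LGL_ord0 => h.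
  suff : -1 < xi i by lra.
  by apply: h; rewrite lt0n.
have [g gE] : exists g, phi i = (1 + 'X) * g.
  have : root (phi i) (-1).
    by rewrite rootE -LGL_ord0 (lagrange_node LGL_inj) (negPf i0).
  move=> /factor_theorem[g ->]; exists g.
  by rewrite mulrC polyCN opprK addrC polyC1.
have phi0 : phi i != 0.
  apply/eqP => /(congr1 (horner^~ (xi i))); rewrite (lagrange_node LGL_inj) eqxx horner0.
  by move/eqP; rewrite oner_eq0.
have g0 : g != 0 by apply: contra phi0; rewrite gE => /eqP ->; rewrite mulr0.
have sg : (size g <= N)%N.
  have := size_lagrange xi i; rewrite gE size_mul//; last first.
    by rewrite -size_poly_gt0 addrC -polyC1 size_XaddC.
  by rewrite addrC -polyC1 size_XaddC.
have wg : w i * g.[xi i] = pint (phi i * g) (-1) 1.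
  rewrite LGL_exact; last first.
    apply: leq_trans (size_polyMleq _ _) _.
    have := size_lagrange xi i; move: sg N_gt0.
    move: (size g) (size (phi i)) => a b; lia.
  rewrite (bigD1 i)//= big1 => [|j ji]; last first.
    by rewrite hornerM (lagrange_node LGL_inj) eq_sym (negPf ji) mul0r mulr0.
  by rewrite hornerM (lagrange_node LGL_inj) eqxx mul1r addr0.
have gi : 0 < g.[xi i].
  have := lagrange_node LGL_inj i i; rewrite gE eqxx hornerM !hornerE => h.
  by rewrite -(pmulr_rgt0 _ xi_gt) h.
rewrite -(pmulr_lgt0 _ gi) wg; apply: pint_gt0; [lra| |by rewrite mulf_neq0].
move=> x x1; rewrite gE -mulrA hornerM mulr_ge0//; first by rewrite !hornerE; lra.
by rewrite hornerM -expr2 sqr_ge0.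
Qed.

(** Each product on the left is an exact quadrature, its integrand having degree at most 2N-1.
    Together they integrate the derivative of phi_i phi_j, whose values at the ends are Kronecker
    deltas because -1 and 1 are the extreme nodes. *)
Lemma sbp i j : w i * Defs.diffmx xi i j + w j * Defs.diffmx xi j i =
  ((i == ord_max) && (j == ord_max))%:R - ((i == ord0) && (j == ord0))%:R.
Proof.
have ex a b : w a * Defs.diffmx xi a b = pint ((phi b)^`() * phi a) (-1) 1.
  rewrite LGL_exact; last first.
    apply: leq_trans (size_polyMleq _ _) _.
    have := size_lagrange xi a; have := size_deriv_le (size_lagrange xi b).
    move: (size _) (size _) N_gt0 => m n; lia.
  rewrite (bigD1 a)//= big1 => [|k ka]; last first.
    by rewrite hornerM (lagrange_node LGL_inj) eq_sym (negPf ka) !mulr0.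
  by rewrite hornerM (lagrange_node LGL_inj) eqxx mulr1 addr0 mxE.
rewrite !ex [_ * phi j]mulrC -pintD -derivM pint_deriv !hornerM.
have ends a : (phi a).[1] = (a == ord_max)%:R /\ (phi a).[-1] = (a == ord0)%:R.
  split; first by rewrite -(lagrange_node LGL_inj) LGL_ord_max.
  by rewrite -(lagrange_node LGL_inj) LGL_ord0.
rewrite !(ends _).1 !(ends _).2 -!natrM !mulnb.
by rewrite [(j == ord_max) && _]andbC [(j == ord0) && _]andbC.
Qed.

Lemma sum_P_CF k i : \sum_j P_CF xi k i j = 1.
Proof.
have := @P_CF_exact _ _ _ LGL_inj 1 k i; rewrite size_poly1 hornerC.
move=> /(_ isT) h; rewrite -[RHS]h.
by apply: eq_bigr => j _; rewrite hornerC mulr1.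
Qed.

Lemma sum_diffmx i : \sum_j Defs.diffmx xi i j = 0.
Proof.
have := @diffmx_exact _ _ _ LGL_inj 1 i; rewrite size_poly1 derivC horner0.
move=> /(_ isT) h; rewrite -[RHS]h.
by apply: eq_bigr => j _; rewrite hornerC mulr1.
Qed.

(** By exactness the left side is built from the integrals over the two halves of [-1,1], which add
    up to the whole; the factor 2 undoes the slope 1/2 of [half]. *)
Lemma LGL_halves p : (size p <= 2 * N)%N ->
  \sum_(k < 2) \sum_i w i * p.[Defs.half k (xi i)] = 2%:R * \sum_j w j * p.[xi j].
Proof.
move=> sp.
have h (k : 'I_2) (c : R) : (forall s, Defs.half k s = 2%:R^-1 * s + c) ->
    \sum_i w i * p.[Defs.half k (xi i)] = 2%:R * pint p (- 2%:R^-1 + c) (2%:R^-1 + c).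
  move=> hk; have := @pint_comp_affine _ p 2%:R^-1 c (-1) 1; rewrite mulrN1 mulr1 => <-.
  rewrite mulrA divff ?mul1r ?pnatr_eq0//.
  rewrite LGL_exact.
    by apply: eq_bigr => i _; rewrite horner_comp !hornerE hk.
  rewrite size_comp_poly2// size_polyDl ?size_scale ?invr_eq0 ?pnatr_eq0//.
    by rewrite size_polyX.
  by rewrite size_polyX size_polyC; case: (c == 0).
rewrite big_ord_recl big_ord1 (h _ (- 2%:R^-1)); last first.
  by move=> s; rewrite /Defs.half/=; lra.
rewrite (h _ 2%:R^-1); last by move=> s; rewrite /Defs.half/=; lra.
rewrite -mulrDr -LGL_exact//; congr (_ * _).
have -> : - 2%:R^-1 + - 2%:R^-1 = -1 :> R by lra.
have -> : 2%:R^-1 + 2%:R^-1 = 1 :> R by lra.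
by rewrite subrr addNr pint_cat.
Qed.

End LGL.

(** * Mesh geometry *)

Section Vec2.
Variable R : realType.
Implicit Types (a b c d : R) (u v : vec2 R).

Lemma mk_vec2_0 a b : mk_vec2 a b 0 0 = a. Proof. by rewrite mxE. Qed.
Lemma mk_vec2_1 a b : mk_vec2 a b 1 0 = b. Proof. by rewrite mxE. Qed.

Lemma vec2P u v : u 0 0 = v 0 0 -> u 1 0 = v 1 0 -> u = v.
Proof.
move=> h0 h1; apply/matrixP => i j; rewrite ord1.
by case: i => -[|[|//]] i; [move: h0|move: h1]; congr (u _ _ = v _ _); exact: val_inj.
Qed.

Lemma dot2E u v : dot2 u v = u 0 0 * v 0 0 + u 1 0 * v 1 0.
Proof.
rewrite /dot2 /dot big_ord_recl big_ord1; congr (_ + u _ _ * v _ _); exact: val_inj.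
Qed.

(** The zero vector is covered too, so a normal can be rebuilt from its length and its unit normal
    without a case distinction. *)
Lemma enorm_scale v : v = enorm v *: ((enorm v)^-1 *: v).
Proof.
have [v0|v0] := eqVneq (enorm v) 0; last by rewrite scalerA divff// scale1r.
have : dot2 v v = 0.
  apply/eqP; rewrite eq_le -sqrtr_eq0 -/(enorm v) v0 eqxx/= dot2E.
  by rewrite addr_ge0// -expr2 sqr_ge0.
rewrite dot2E -!expr2 => /eqP; rewrite paddr_eq0 ?sqr_ge0// !sqrf_eq0.
move=> /andP[/eqP h0 /eqP h1]; rewrite v0 scale0r.
by apply: vec2P; rewrite mxE.
Qed.

End Vec2.

(** * Restriction of bivariate polynomials to coordinate lines *)

Section BivariatePolynomials.
Variable R : realType.
Implicit Types (p : {poly {poly R}}) (x y : R) (s : side).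

(** Since xi is the outer variable, fixing eta evaluates every coefficient, whereas fixing xi, in
    [eta_section], evaluates the outer polynomial at a constant. *)
Definition xi_section p y : {poly R} := map_poly (horner_eval y) p.
Definition eta_section p x : {poly R} := p.[x%:P].

Lemma xi_sectionE p x y : (xi_section p y).[x] = eval2 p x y.
Proof.
by have := horner_map (horner_eval y) p x%:P; rewrite /= !horner_evalE hornerC.
Qed.

Lemma eta_sectionE p x y : (eta_section p x).[y] = eval2 p x y.
Proof. by []. Qed.

Lemma deriv_xi_section p y : (xi_section p y)^`() = xi_section (d_xi p) y.
Proof. by rewrite /xi_section deriv_map. Qed.

Lemma size_d_eta p : (size (d_eta p) <= size p)%N.
Proof. exact: size_poly. Qed.

Lemma coef_d_eta p i : (d_eta p)`_i = (p`_i)^`().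
Proof. by rewrite /d_eta coef_map_id0 ?deriv0. Qed.

Lemma deriv_eta_section p x : (eta_section p x)^`() = eta_section (d_eta p) x.
Proof.
rewrite /eta_section (horner_coef_wide _ (size_d_eta p)) horner_coef raddf_sum.
apply: eq_bigr => i _ /=.
by rewrite coef_d_eta -polyC_exp mulrC deriv_mulC mulrC.
Qed.

Lemma d_xi_eta p : d_xi (d_eta p) = d_eta (d_xi p).
Proof.
by apply/polyP => i; rewrite coef_deriv !coef_d_eta coef_deriv derivMn.
Qed.

Variable N : nat.

Lemma size_xi_section p y : in_QN N p -> (size (xi_section p y) <= N.+1)%N.
Proof. by case=> + _; apply: leq_trans; exact: size_poly. Qed.

Lemma size_eta_section p x : in_QN N p -> (size (eta_section p x) <= N.+1)%N.
Proof.
case=> _ pN; rewrite /eta_section horner_coef.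
apply: leq_trans (size_sum _ _ _) _; apply/bigmax_leqP => i _.
rewrite -polyC_exp mulrC mul_polyC.
by apply: leq_trans (size_scale_leq _ _) _.
Qed.

Lemma in_QN_d_xi p : in_QN N p -> in_QN N (d_xi p).
Proof.
case=> s1 s2; split=> [|i].
  by apply: leq_trans (size_deriv_le s1) _; exact: leqnSn.
apply/leq_sizeP => j Nj; rewrite coef_deriv coefMn nth_default ?mul0rn//.
exact: leq_trans Nj.
Qed.

Lemma in_QN_d_eta p : in_QN N p -> in_QN N (d_eta p).
Proof.
case=> s1 s2; split=> [|i]; first exact: leq_trans (size_d_eta p) s1.
rewrite coef_d_eta.
by apply: leq_trans (size_deriv_le (s2 _)) _; exact: leqnSn.
Qed.

Definition edge_poly s p : {poly R} :=
  if s.1 then xi_section p (side_sign R s) else eta_section p (side_sign R s).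

Lemma edge_polyE s p t : (edge_poly s p).[t] = on_side s (eval2 p) t.
Proof. by rewrite /edge_poly /on_side; case: s.1; rewrite ?xi_sectionE. Qed.

Lemma size_edge_poly s p : in_QN N p -> (size (edge_poly s p) <= N.+1)%N.
Proof.
by rewrite /edge_poly; case: s.1; [exact: size_xi_section|exact: size_eta_section].
Qed.

Lemma deriv_edge_poly s p :
  (edge_poly s p)^`() = edge_poly s (if s.1 then d_xi p else d_eta p).
Proof.
by rewrite /edge_poly; case: s.1; rewrite ?deriv_xi_section ?deriv_eta_section.
Qed.

(** The differentiation matrix is exact on the restrictions, which have degree at most N, so both
    sides are the mixed second derivative of [p] at the node. *)
Lemma metric_identity (xi : 'I_N.+1 -> R) p i j : injective xi -> in_QN N p ->
  \sum_m Defs.diffmx xi i m * eval2 (d_eta p) (xi m) (xi j) =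
  \sum_n Defs.diffmx xi j n * eval2 (d_xi p) (xi i) (xi n).
Proof.
move=> xi_inj pN.
under eq_bigr do rewrite -xi_sectionE.
rewrite (diffmx_exact xi_inj) ?size_xi_section//; last exact: in_QN_d_eta.
rewrite deriv_xi_section xi_sectionE d_xi_eta -eta_sectionE -deriv_eta_section.
rewrite -(diffmx_exact xi_inj)//; apply: size_eta_section; exact: in_QN_d_xi.
Qed.

End BivariatePolynomials.

(** * Metric-scaled normals along edges *)

Section Normals.
Variables (R : realType) (N Ne : nat) (M : mesh R Ne).
Variable (xi : 'I_N.+1 -> R).
Hypotheses (N_gt0 : (0 < N)%N) (xi_LGL : LGL_nodes xi).
Hypothesis iso : isoparametric M N.
Implicit Types (E F C : edge Ne).

Definition edge_x E := edge_poly E.2 (map_x M E.1).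
Definition edge_y E := edge_poly E.2 (map_y M E.1).

(** The right-hand side is the adjugate of the Jacobian matrix. *)
Lemma jacobian_invmx e x y : jac M e x y != 0 ->
  jac M e x y *: invmx (jacobian_mx M e x y) =
  \matrix_(i < 2, j < 2)
    nth 0 (nth [::] [:: [:: y_eta M e x y; - x_eta M e x y];
                        [:: - y_xi M e x y; x_xi M e x y]] i) j.
Proof.
move=> J0; set A := jacobian_mx _ _ _ _; set B := \matrix_(_, _) _.
have AB : A *m ((jac M e x y)^-1 *: B) = 1%:M.
  apply/matrixP => i j; rewrite !mxE big_ord_recl big_ord1 !mxE/=.
  case: i => -[|[|//]] ? ; case: j => -[|[|//]] ?; rewrite /= /jac in J0 *;
  rewrite -?[in RHS]val_eqE /=; field; exact: J0.
have [uA _] := mulmx1_unit AB.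
have -> : invmx A = (jac M e x y)^-1 *: B.
  by rewrite -[LHS]mulmx1 -AB mulKmx.
by rewrite scalerA divff// scale1r.
Qed.

(** The sign that makes (y', -x'), the edge tangent turned clockwise, point outward: on two of the
    four sides the edge coordinate runs clockwise around the element. *)
Definition edge_orient (s : side) : R := side_sign R s * (if s.1 then -1 else 1).

Lemma normalE E t : -1 <= t <= 1 ->
  normal M E t = edge_orient E.2 *:
    mk_vec2 (edge_y E)^`().[t] (- (edge_x E)^`().[t]).
Proof.
case: E => e s t1; have [_ _ J] := iso e.
have s1 : -1 <= side_sign R s <= 1 by rewrite /side_sign; case: s.2; lra.
rewrite /edge_x /edge_y !deriv_edge_poly !edge_polyE.
rewrite /normal /on_side /edge_orient /ref_normal /=.
have JT n x y : jac M e x y != 0 ->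
    jac M e x y *: ((invmx (jacobian_mx M e x y))^T *m n) =
    mk_vec2 (y_eta M e x y * n 0 0 - y_xi M e x y * n 1 0)
            (- x_eta M e x y * n 0 0 + x_xi M e x y * n 1 0).
  move=> J0; rewrite scalemxAl -linearZ/= jacobian_invmx//.
  apply: vec2P; rewrite !mxE big_ord_recl big_ord1 !mxE/=.
    by congr (_ + _); rewrite -mulNr; congr (_ * n _ _); exact: val_inj.
  by congr (_ + _ * n _ _); exact: val_inj.
case: s.1; rewrite JT ?gt_eqF ?J//; apply: vec2P;
  rewrite !mxE /= /y_eta /y_xi /x_eta /x_xi; ring.
Qed.

Lemma enorm_normal E t : -1 <= t <= 1 ->
  enorm (normal M E t) =
  Num.sqrt ((edge_x E)^`().[t] ^+ 2 + (edge_y E)^`().[t] ^+ 2).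
Proof.
move=> t1; rewrite normalE// /enorm dot2E !mxE /=; congr Num.sqrt.
have s2 : edge_orient E.2 * edge_orient E.2 = 1.
  rewrite /edge_orient /side_sign; case: E.2.1; case: E.2.2; ring.
by move: (edge_orient _) s2 => a a2; rewrite -[RHS]mul1r -a2; ring.
Qed.

Lemma positionE E t :
  position M E t = mk_vec2 (edge_x E).[t] (edge_y E).[t].
Proof. by rewrite /edge_x /edge_y !edge_polyE /position /on_side; case: ifP. Qed.

Lemma half_bounds k (t : R) : -1 <= t <= 1 -> -1 <= Defs.half k t <= 1.
Proof. by rewrite /Defs.half; case: ifP => _; lra. Qed.

Lemma flip_bounds r (t : R) : -1 <= t <= 1 -> -1 <= flip_coord r t <= 1.
Proof. by case: r => /=; lra. Qed.

(* Both edges parametrize the same curve up to translation, so the coarse tangent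
   is, up to sign, twice the fine one; this fixes the ratio of the normals, whose
   directions are opposite. *)
Lemma fine_normal F C k r t : fine_coarse_matching M F C k r -> -1 <= t <= 1 ->
  normal M F (flip_coord r t) = - 2%:R^-1 *: normal M C (Defs.half k t).
Proof.
move=> [z h] t1.
have [a [c [a2 fE]]] : exists a c : R, a ^+ 2 = 1 /\ forall t, flip_coord r t = a * t + c.
  exists (if r then -1 else 1), 0; split; first by case: (r); ring.
  by move=> t'; case: (r) => /=; ring.
have [c' hE] : exists c' : R, forall t, Defs.half k t = 2%:R^-1 * t + c'.
  exists (if k == 0 then - 2%:R^-1 else 2%:R^-1) => t'.
  by rewrite /Defs.half; case: ifP; lra.
(* Equality of positions on all of [-1,1] is an equality of polynomials, so it can be
   differentiated; [a] and 1/2 are the slopes of the two parametrizations. *)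
have tang (p q : {poly R}) d : (forall t, -1 <= t <= 1 ->
    p.[flip_coord r t] = q.[Defs.half k t] + d) ->
    a * p^`().[flip_coord r t] = 2%:R^-1 * q^`().[Defs.half k t].
  move=> pq.
  have : p \Po (a *: 'X + c%:P) = q \Po (2%:R^-1 *: 'X + c'%:P) + d%:P.
    apply: (@poly_eq_itv R (-1) 1) => [|x x1]; first by lra.
    by rewrite hornerD !horner_comp !hornerE -fE -hE pq.
  move/(congr1 (fun p => p^`().[t])); rewrite derivD derivC addr0 !deriv_comp.
  rewrite !derivD !derivZ !derivX !derivC !addr0 !alg_polyC ![_ * _%:P]mulrC.
  rewrite !mul_polyC !hornerZ !horner_comp !hornerD !hornerZ !hornerX !hornerC.
  by rewrite -fE -hE.
have tx : a * (edge_x F)^`().[flip_coord r t] = 2%:R^-1 * (edge_x C)^`().[Defs.half k t].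
  apply: (tang _ _ (Defs.shift M z 0 0)) => t' t'1.
  have [+ _] := h _ t'1; rewrite !positionE.
  by move=> /(congr1 (fun v : vec2 R => v 0 0)); rewrite !mxE.
have ty : a * (edge_y F)^`().[flip_coord r t] = 2%:R^-1 * (edge_y C)^`().[Defs.half k t].
  apply: (tang _ _ (Defs.shift M z 1 0)) => t' t'1.
  have [+ _] := h _ t'1; rewrite !positionE.
  by move=> /(congr1 (fun v : vec2 R => v 1 0)); rewrite !mxE.
have nE : enorm (normal M F (flip_coord r t)) =
    2%:R^-1 * enorm (normal M C (Defs.half k t)).
  rewrite !enorm_normal ?half_bounds ?flip_bounds//.
  have h2 : 0 <= 2%:R^-1 :> R by rewrite invr_ge0.
  rewrite -[in RHS](ger0_norm h2) -sqrtr_sqr -sqrtrM ?sqr_ge0//; congr Num.sqrt.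
  rewrite mulrDr -!exprMn -tx -ty !exprMn a2; ring.
rewrite [LHS]enorm_scale -/(unit_normal M F _) nE.
have [_ ->] := h _ t1.
by rewrite scalerN scaleNr -scalerA /unit_normal -enorm_scale.
Qed.

(** [b] selects the component: [false] for x and [true] for y. The degree is at most N-1, so the
    product with a basis polynomial is still integrated exactly. *)
Definition normal_poly E (b : bool) : {poly R} :=
  edge_orient E.2 *: (if b then - (edge_x E)^`() else (edge_y E)^`()).

Lemma size_normal_poly E b : (size (normal_poly E b) <= N)%N.
Proof.
have [mx my _] := iso E.1.
rewrite /normal_poly; apply: leq_trans (size_scale_leq _ _) _.
by case: b; rewrite ?size_polyN; apply: (@size_deriv_le _ _ N.+1); exact: size_edge_poly.
Qed.

Lemma normal_polyE E t : -1 <= t <= 1 ->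
  normal M E t = mk_vec2 (normal_poly E false).[t] (normal_poly E true).[t].
Proof.
by move=> t1; rewrite normalE//; apply: vec2P; rewrite !mxE/= !hornerE.
Qed.

End Normals.

(** * Chain rule for the entropy *)

Section EntropyChainRule.
Variable R : realType.
Implicit Types (x : state R).

Lemma differentiable_entropy x : admissible x -> differentiable (@entropy R) x.
Proof.
move=> [rho_gt0 p_gt0].
have dc (k : 'I_4) : differentiable (fun y : state R => y 0 k : R) x.
  exact: differentiable_coord.
have dV : differentiable (fun y : state R => (density y)^-1) x.
  by apply: differentiableV; [exact: dc|rewrite gt_eqF].
have dp : differentiable (@pressure R) x.
  apply: differentiableM; first exact: differentiable_cst.
  apply: differentiableB; first exact: dc.
  apply: differentiableM; last exact: differentiable_cst.
  apply: differentiableM; first exact: dc.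
  have dv (f : state R -> R) : differentiable f x ->
      differentiable (fun y => (f y / density y) ^+ 2) x.
    move=> df; apply: (@differentiableM _ _ (fun y => f y / density y)
      (fun y => f y / density y)); exact: differentiableM.
  by apply: differentiableD; apply: dv; exact: dc.
apply: differentiableM; last exact: differentiable_cst.
apply: differentiableN; apply: differentiableM; first exact: dc.
have dpow : differentiable (fun y : state R => density y `^ (- gamma R)) x.
  apply: (@differentiable_comp _ _ _ _ (@density R) (fun a => a `^ (- gamma R))).
    exact: dc.
  by apply/derivable1_diffP; apply: ex_derive; exact: is_derive1_powR.
apply: (@differentiable_comp _ _ _ _
  (fun y : state R => pressure y * density y `^ (- gamma R)) (@ln R)).
  exact: differentiableM.
apply/derivable1_diffP; apply: ex_derive; apply: is_derive1_ln.
by rewrite mulr_gt0// powR_gt0.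
Qed.

Lemma entropy_chain_rule (U : R -> state R) t :
  admissible (U t) -> derivable U t 1 ->
  derive1 (fun s => entropy (U s)) t = dot_state (entropy_vars (U t)) (derive1 U t).
Proof.
move=> aU dU; have de := differentiable_entropy aU.
have dU' : differentiable U t by apply/derivable1_diffP.
rewrite derive1E'; last exact: differentiable_comp.
rewrite (@diff_comp _ _ _ _ U (@entropy R))//= -derive1E'//.
(* The differential is expanded over the basis rows, where it yields the partial derivatives that
   define [entropy_vars]. *)
set v := derive1 U t; rewrite [in LHS](row_sum_delta v) linear_sum /dot_state /dot.
apply: eq_bigr => k _; rewrite linearZ/= mxE deriveE// mulrC.
by [].
Qed.

End EntropyChainRule.

(** * Volume terms *)

Section DotState.
Variable R : realType.
Implicit Types (U V W : state R).

Lemma dot_stateDr W U V : dot_state W (U + V) = dot_state W U + dot_state W V.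
Proof.
by rewrite /dot_state /dot -big_split; apply: eq_bigr => k _; rewrite mxE mulrDr.
Qed.

Lemma dot_stateZr W c U : dot_state W (c *: U) = c * dot_state W U.
Proof.
by rewrite /dot_state /dot mulr_sumr; apply: eq_bigr => k _; rewrite mxE mulrCA.
Qed.

Lemma dot_stateNr W U : dot_state W (- U) = - dot_state W U.
Proof. by rewrite -scaleN1r dot_stateZr mulN1r. Qed.

Lemma dot_state_sumr W I (r : seq I) (P : pred I) (F : I -> state R) :
  dot_state W (\sum_(i <- r | P i) F i) = \sum_(i <- r | P i) dot_state W (F i).
Proof.
elim/big_rec2: _ => [|i x y _ <-]; last exact: dot_stateDr.
by rewrite -(scale0r 0) dot_stateZr mul0r.
Qed.

Lemma dot_stateBl U V W : dot_state (U - V) W = dot_state U W - dot_state V W.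
Proof.
rewrite /dot_state /dot -sumrB; apply: eq_bigr => k _.
by rewrite !mxE mulrBl.
Qed.

(** The shape of [dgsem_residual] with abstract coefficients, tested against [W] and solved for the
    time derivative. *)
Lemma dot_state_eq0 W n (a b c d e : R) (cF cG : 'I_n -> R)
    (F G : 'I_n -> state R) U1 U2 U3 :
  a *: (d *: U1 + e *: (\sum_m cF m *: F m) + e *: (\sum_m cG m *: G m))
    + b *: U2 + c *: U3 = 0 ->
  a * d * dot_state W U1 =
  - (a * (e * \sum_m cF m * dot_state W (F m)))
  - a * (e * \sum_m cG m * dot_state W (G m))
  - b * dot_state W U2 - c * dot_state W U3.
Proof.
move/(congr1 (dot_state W)).
rewrite -[0 in RHS](scale0r 0) [RHS]dot_stateZr mul0r.
rewrite !(dot_stateDr, dot_stateZr) !dot_state_sumr.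
under eq_bigr do rewrite dot_stateZr.
under [X in _ + e * X]eq_bigr do rewrite dot_stateZr.
lra.
Qed.

Lemma dot_state0l U : dot_state 0 U = 0.
Proof. by rewrite /dot_state /dot big1// => k _; rewrite mxE mul0r. Qed.

Lemma dot_state_delta k U : dot_state (delta_mx 0 k) U = U 0 k.
Proof.
rewrite /dot_state /dot (bigD1 k)//= mxE !eqxx mul1r big1 ?addr0// => l lk.
by rewrite mxE eqxx (negPf lk) mul0r.
Qed.

End DotState.

(** * Summation by parts along a line of nodes *)

Section Lines.
Variables (R : realType) (N : nat) (xi : 'I_N.+1 -> R).
Hypotheses (N_gt0 : (0 < N)%N) (xi_LGL : LGL_nodes xi).
Implicit Types (a b P Q : 'I_N.+1 -> R) (G h : 'I_N.+1 -> 'I_N.+1 -> R).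
Local Notation D := (Defs.diffmx xi).
Local Notation w := (weight xi).

Lemma sbp_sum h :
  \sum_i \sum_m (w i * D i m + w m * D m i) * h i m =
  h ord_max ord_max - h ord0 ord0.
Proof.
under eq_bigr => i _ do under eq_bigr => m _ do
  rewrite sbp// mulrBl -!mulnb !natrM -!mulrA.
have d k (f : 'I_N.+1 -> R) : \sum_i (i == k)%:R * f i = f k.
  exact: (@sum_delta _ _ R^o f k).
under eq_bigr => i _ do rewrite sumrB -!mulr_sumr !d.
by rewrite sumrB !d.
Qed.

(** Twice the summand splits into four products. The one with both factors at [i] vanishes because
    the rows of [D] sum to zero, [X] is the one with [P i] and [a m], and the other two are reduced
    by summation by parts. *)
Lemma line_potential a P :
  \sum_i \sum_m w i * D i m * (mean (a i) (a m) * (P i - P m)) =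
  - (a ord_max * P ord_max - a ord0 * P ord0)
  + \sum_i w i * (P i * \sum_m D i m * a m).
Proof.
set T := LHS; set X := \sum_i w i * _.
have XE : X = \sum_i \sum_m w i * D i m * (P i * a m).
  by apply: eq_bigr => i _; rewrite !mulr_sumr; apply: eq_bigr => m _; ring.
have S1 : \sum_i \sum_m w i * D i m * (a i * P i) = 0.
  rewrite big1// => i _; rewrite -mulr_suml -mulr_sumr.
  by rewrite (sum_diffmx xi_LGL) mulr0 mul0r.
have S2 : \sum_i \sum_m w i * D i m * (a m * P m) =
    a ord_max * P ord_max - a ord0 * P ord0.
  rewrite exchange_big /= -[RHS](sbp_sum (fun i _ => a i * P i)).
  (* Adding the vanishing sum [S1] supplies the transposed half that [sbp_sum] requires. *)
  rewrite -[LHS]add0r -[X in X + _ = _]S1.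
  rewrite -big_split; apply: eq_bigr => i _; rewrite /= -big_split.
  by apply: eq_bigr => m _ /=; ring.
have S3 : \sum_i \sum_m w i * D i m * (a i * P m) =
    a ord_max * P ord_max - a ord0 * P ord0 - X.
  rewrite exchange_big /= -(sbp_sum (fun i m => a m * P i)) XE.
  rewrite -sumrB; apply: eq_bigr => i _; rewrite /= -sumrB.
  by apply: eq_bigr => m _ /=; ring.
suff : 2%:R * T = - (a ord_max * P ord_max - a ord0 * P ord0)
    - (a ord_max * P ord_max - a ord0 * P ord0) + X + X by lra.
transitivity (\sum_i \sum_m w i * D i m * (a i * P i)
  - \sum_i \sum_m w i * D i m * (a m * P m) + X
  - \sum_i \sum_m w i * D i m * (a i * P m)); last by rewrite S1 S2 S3; ring.
rewrite XE /T mulr_sumr -sumrB -big_split -sumrB; apply: eq_bigr => i _ /=.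
rewrite mulr_sumr -sumrB -big_split -sumrB; apply: eq_bigr => m _ /=.
by rewrite /mean; field.
Qed.

(* G i m stands for W_i . F(U_i, U_m): by symmetry of F the hypothesis is the
   entropy conservation of F, with metric terms a, b and potentials P, Q. *)
Lemma line_sum G a b P Q :
  (forall i m, G i m - G m i =
     mean (a i) (a m) * (P i - P m) + mean (b i) (b m) * (Q i - Q m)) ->
  \sum_i w i * (2%:R * \sum_m D i m * G i m) =
    (G ord_max ord_max - (a ord_max * P ord_max + b ord_max * Q ord_max))
  - (G ord0 ord0 - (a ord0 * P ord0 + b ord0 * Q ord0))
  + \sum_i w i * (P i * (\sum_m D i m * a m) + Q i * (\sum_m D i m * b m)).
Proof.
move=> GE.
have -> : \sum_i w i * (P i * (\sum_m D i m * a m) + Q i * (\sum_m D i m * b m)) =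
    \sum_i w i * (P i * \sum_m D i m * a m) + \sum_i w i * (Q i * \sum_m D i m * b m).
  by rewrite -big_split; apply: eq_bigr => i _; rewrite mulrDr.
transitivity (\sum_i \sum_m w i * D i m * (mean (a i) (a m) * (P i - P m))
  + \sum_i \sum_m w i * D i m * (mean (b i) (b m) * (Q i - Q m))
  + \sum_i \sum_m (w i * D i m + w m * D m i) * G m i); last first.
  by rewrite sbp_sum !line_potential; ring.
(* One of the two copies of the sum is transposed, and in the other [G i m] is [G m i] plus the jump
   from [GE]: the [G m i] terms then form a summation-by-parts pair. *)
have sw : \sum_i \sum_m w i * D i m * G i m = \sum_i \sum_m w m * D m i * G m i.
  by rewrite exchange_big.
transitivity (\sum_i \sum_m w i * D i m * G i m + \sum_i \sum_m w i * D i m * G i m).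
  rewrite -big_split; apply: eq_bigr => i _.
  by rewrite /= -big_split !mulr_sumr; apply: eq_bigr => m _ /=; ring.
rewrite {2}sw -!big_split; apply: eq_bigr => i _ /=.
rewrite -!big_split; apply: eq_bigr => m _ /=.
by rewrite -[G i m](subrK (G m i)) GE; ring.
Qed.

End Lines.

(** [X] and [S] are collected along lines of constant [j], [Y] and [T] along lines of constant [i],
    so that each direction reduces to one-dimensional identities. *)
Lemma sum_split_directions (R : realType) n (w : 'I_n -> R)
    (A X Y S T : 'I_n -> 'I_n -> R) :
  (forall i j, A i j = - (w i * w j * X i j) - w i * w j * Y i j
     - w i * T i j - w j * S i j) ->
  \sum_i \sum_j A i j =
  - \sum_j w j * (\sum_i w i * X i j + \sum_i S i j)
  - \sum_i w i * (\sum_j w j * Y i j + \sum_j T i j).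
Proof.
move=> AE.
have -> : \sum_j w j * (\sum_i w i * X i j + \sum_i S i j) =
    \sum_i \sum_j (w i * w j * X i j + w j * S i j).
  rewrite exchange_big; apply: eq_bigr => j _ /=.
  by rewrite -big_split mulr_sumr; apply: eq_bigr => i _ /=; ring.
have -> : \sum_i w i * (\sum_j w j * Y i j + \sum_j T i j) =
    \sum_i \sum_j (w i * w j * Y i j + w i * T i j).
  apply: eq_bigr => i _.
  by rewrite -big_split mulr_sumr; apply: eq_bigr => j _ /=; ring.
rewrite -sumrN -sumrB; apply: eq_bigr => i _ /=.
rewrite -sumrN -sumrB; apply: eq_bigr => j _ /=.
by rewrite AE; ring.
Qed.

Lemma sum_sides (A : nmodType) (F : side -> A) :
  \sum_s F s = F (true, true) + F (true, false) + (F (false, true) + F (false, false)).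
Proof.
rewrite (eq_bigr (fun s => F (s.1, s.2))); last by case.
by rewrite -(pair_bigA _ (fun a b => F (a, b))) /= !big_bool.
Qed.

(** * Balance on a single element for a general test function *)

Section Elements.
Variables (R : realType) (N Ne : nat) (xi : 'I_N.+1 -> R) (M : mesh R Ne).
Hypotheses (N_gt0 : (0 < N)%N) (xi_LGL : LGL_nodes xi).
Hypothesis iso : isoparametric M N.
Variables (fsharp gsharp : state R -> state R -> state R).
Hypotheses (f_sym : symmetric_flux fsharp) (g_sym : symmetric_flux gsharp).
Hypotheses (f_cons : consistent_flux (@flux_f R) fsharp).
Hypotheses (g_cons : consistent_flux (@flux_g R) gsharp).
Variables (alpha : edge Ne -> 'I_N.+1 -> R).
Variables (U : 'I_Ne -> 'I_N.+1 -> 'I_N.+1 -> state R).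
Hypothesis U_adm : forall e i j, admissible (U e i j).
Variables (W : state R -> state R) (pf pg : state R -> R).
Hypothesis f_pot : forall UL UR, admissible UL -> admissible UR ->
  dot_state (W UR - W UL) (fsharp UL UR) = pf UR - pf UL.
Hypothesis g_pot : forall UL UR, admissible UL -> admissible UR ->
  dot_state (W UR - W UL) (gsharp UL UR) = pg UR - pg UL.
Implicit Types (e : 'I_Ne) (s : side) (E F C : edge Ne) (i j m n : 'I_N.+1).
Local Notation D := (Defs.diffmx xi).
Local Notation w := (weight xi).

Lemma normal_map e s t : -1 <= t <= 1 ->
  normal M (e, s) t = side_sign R s *:
    (if s.1 then mk_vec2 (- y_xi M e t (side_sign R s)) (x_xi M e t (side_sign R s))
     else mk_vec2 (y_eta M e (side_sign R s) t) (- x_eta M e (side_sign R s) t)).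
Proof.
move=> t1; rewrite (normalE iso)//= /edge_x /edge_y /= !deriv_edge_poly !edge_polyE.
rewrite /edge_orient /on_side; case: s.1; rewrite ?mulr1// mulrN1.
by apply: vec2P; rewrite !mxE/= ?mulrNN ?mulrN ?mulNr ?opprK.
Qed.

(** A numerical entropy flux out of the element when [W] is the entropy variables; for constant [W]
    and zero potentials, the outflow of a linear combination of the conserved variables. *)
Definition edge_production E l : R :=
  dot_state (W (trace U E l)) (numerical_flux xi M alpha U E l)
  - (pf (trace U E l) * node_normal xi M E l 0 0
     + pg (trace U E l) * node_normal xi M E l 1 0).

Lemma edge_productionE e s l : edge_production (e, s) l =
  dot_state (W (trace U (e, s) l)) (numerical_flux xi M alpha U (e, s) l)
  - side_sign R s *
  (if s.1 then - y_xi M e (xi l) (side_sign R s) * pf (trace U (e, s) l)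
               + x_xi M e (xi l) (side_sign R s) * pg (trace U (e, s) l)
   else y_eta M e (side_sign R s) (xi l) * pf (trace U (e, s) l)
        + - x_eta M e (side_sign R s) (xi l) * pg (trace U (e, s) l)).
Proof.
rewrite /edge_production /node_normal (normal_map _ _ (LGL_bounds N_gt0 xi_LGL l)).
congr (_ - _); case: s.1; rewrite !mxE/=; ring.
Qed.

Lemma ftilde_sharp_sym e i m j :
  ftilde_sharp xi M fsharp gsharp U e m i j = ftilde_sharp xi M fsharp gsharp U e i m j.
Proof.
rewrite /ftilde_sharp (f_sym (U_adm e m j) (U_adm e i j)).
rewrite (g_sym (U_adm e m j) (U_adm e i j)).
by rewrite /mean ![_ (xi m) (xi j) + _]addrC.
Qed.

Lemma gtilde_sharp_sym e i j n :
  gtilde_sharp xi M fsharp gsharp U e i n j = gtilde_sharp xi M fsharp gsharp U e i j n.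
Proof.
rewrite /gtilde_sharp (f_sym (U_adm e i n) (U_adm e i j)).
rewrite (g_sym (U_adm e i n) (U_adm e i j)).
by rewrite /mean ![_ (xi i) (xi n) + _]addrC.
Qed.

Lemma meanxx (a : R) : mean a a = a.
Proof. by rewrite /mean; field. Qed.

Lemma ftilde_sharp_cons e i j :
  ftilde_sharp xi M fsharp gsharp U e i i j = ftilde xi M U e i j.
Proof. by rewrite /ftilde_sharp !meanxx f_cons ?g_cons. Qed.

Lemma gtilde_sharp_cons e i j :
  gtilde_sharp xi M fsharp gsharp U e i j j = gtilde xi M U e i j.
Proof. by rewrite /gtilde_sharp !meanxx f_cons ?g_cons. Qed.

Lemma dot_state_lin2 V (a b : R) X Y :
  dot_state V (a *: X + b *: Y) = a * dot_state V X + b * dot_state V Y.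
Proof. by rewrite dot_stateDr !dot_stateZr. Qed.

Lemma sum_dot_ends (V : 'I_N.+1 -> state R) X Y :
  \sum_i dot_state (V i) ((i == ord0)%:R *: X - (i == ord_max)%:R *: Y) =
  dot_state (V ord0) X - dot_state (V ord_max) Y.
Proof.
rewrite -(@sum_delta _ _ R^o (fun i => dot_state (V i) X) ord0).
rewrite -(@sum_delta _ _ R^o (fun i => dot_state (V i) Y) ord_max).
by rewrite -sumrB; apply: eq_bigr => i _; rewrite -scaleNr dot_state_lin2 mulNr.
Qed.

Lemma dot_delta V (c : R) X Y :
  dot_state V (X - c *: Y) = dot_state V X - c * dot_state V Y.
Proof. by rewrite dot_stateDr dot_stateNr dot_stateZr. Qed.

(** The physical fluxes that [line_sum] leaves at the two ends cancel against those in [delta_f], so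
    only numerical fluxes and potentials remain there. The last sum holds the metric terms, which
    cancel only in combination with the other direction. *)
Lemma f_line e j :
  \sum_i w i * (2%:R * \sum_m D i m *
     dot_state (W (U e i j)) (ftilde_sharp xi M fsharp gsharp U e i m j))
  + \sum_i dot_state (W (U e i j))
     ((i == ord0)%:R *: delta_f xi M alpha U e ord0 j false
      - (i == ord_max)%:R *: delta_f xi M alpha U e ord_max j true) =
  edge_production (e, (false, true)) j + edge_production (e, (false, false)) j
  + \sum_i w i * (pf (U e i j) * (\sum_m D i m * y_eta M e (xi m) (xi j))
      + pg (U e i j) * (\sum_m D i m * - x_eta M e (xi m) (xi j))).
Proof.
rewrite (line_sum N_gt0 xi_LGL (a := fun i => y_eta M e (xi i) (xi j))
  (b := fun i => - x_eta M e (xi i) (xi j))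
  (P := fun i => pf (U e i j)) (Q := fun i => pg (U e i j))); last first.
  move=> i m; rewrite ftilde_sharp_sym -dot_stateBl /ftilde_sharp -scaleNr dot_state_lin2.
  by rewrite f_pot// g_pot// /mean; ring.
rewrite (sum_dot_ends (fun i => W (U e i j))) !ftilde_sharp_cons.
rewrite !edge_productionE /delta_f !dot_delta /trace /side_sign /=.
rewrite (LGL_ord0 N_gt0 xi_LGL) (LGL_ord_max N_gt0 xi_LGL).
by move: (\sum_(i < N.+1) _) => S; ring.
Qed.

Lemma g_line e i :
  \sum_j w j * (2%:R * \sum_n D j n *
     dot_state (W (U e i j)) (gtilde_sharp xi M fsharp gsharp U e i j n))
  + \sum_j dot_state (W (U e i j))
     ((j == ord0)%:R *: delta_g xi M alpha U e i ord0 false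
      - (j == ord_max)%:R *: delta_g xi M alpha U e i ord_max true) =
  edge_production (e, (true, true)) i + edge_production (e, (true, false)) i
  + \sum_j w j * (pf (U e i j) * (\sum_n D j n * - y_xi M e (xi i) (xi n))
      + pg (U e i j) * (\sum_n D j n * x_xi M e (xi i) (xi n))).
Proof.
rewrite (line_sum N_gt0 xi_LGL (a := fun j => - y_xi M e (xi i) (xi j))
  (b := fun j => x_xi M e (xi i) (xi j))
  (P := fun j => pf (U e i j)) (Q := fun j => pg (U e i j))); last first.
  move=> j m; rewrite gtilde_sharp_sym -dot_stateBl /gtilde_sharp dot_state_lin2.
  by rewrite f_pot// g_pot// /mean; ring.
rewrite (sum_dot_ends (fun j => W (U e i j))) !gtilde_sharp_cons.
rewrite !edge_productionE /delta_g !dot_delta /trace /side_sign /=.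
rewrite (LGL_ord0 N_gt0 xi_LGL) (LGL_ord_max N_gt0 xi_LGL).
by move: (\sum_(i < N.+1) _) => S; ring.
Qed.

Lemma element_balance (dU : 'I_Ne -> 'I_N.+1 -> 'I_N.+1 -> state R) e :
  (forall i j, dgsem_residual xi M fsharp gsharp alpha U dU e i j = 0) ->
  \sum_i \sum_j w i * w j * jac M e (xi i) (xi j)
    * dot_state (W (U e i j)) (dU e i j) =
  - \sum_(s : side) \sum_l w l * edge_production (e, s) l.
Proof.
move=> res0.
pose A i j := w i * w j * jac M e (xi i) (xi j) * dot_state (W (U e i j)) (dU e i j).
pose Gf j i m := dot_state (W (U e i j)) (ftilde_sharp xi M fsharp gsharp U e i m j).
pose Gg i j n := dot_state (W (U e i j)) (gtilde_sharp xi M fsharp gsharp U e i j n).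
pose Sf i j := dot_state (W (U e i j))
   ((i == ord0)%:R *: delta_f xi M alpha U e ord0 j false
            - (i == ord_max)%:R *: delta_f xi M alpha U e ord_max j true).
pose Sg i j := dot_state (W (U e i j))
   ((j == ord0)%:R *: delta_g xi M alpha U e i ord0 false
            - (j == ord_max)%:R *: delta_g xi M alpha U e i ord_max true).
have resE i j : A i j = - (w i * w j * (2%:R * \sum_m D i m * Gf j i m))
    - w i * w j * (2%:R * \sum_n D j n * Gg i j n)
    - w i * Sg i j - w j * Sf i j.
  exact: dot_state_eq0 (res0 i j).
rewrite (sum_split_directions resE).
pose vF j := \sum_i w i * (pf (U e i j) * (\sum_m D i m * y_eta M e (xi m) (xi j))
      + pg (U e i j) * (\sum_m D i m * - x_eta M e (xi m) (xi j))).
pose vG i := \sum_j w j * (pf (U e i j) * (\sum_n D j n * - y_xi M e (xi i) (xi n))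
      + pg (U e i j) * (\sum_n D j n * x_xi M e (xi i) (xi n))).
pose P s l := edge_production (e, s) l.
transitivity (- (\sum_j w j * (P (false, true) j + P (false, false) j + vF j))
  - (\sum_i w i * (P (true, true) i + P (true, false) i + vG i))).
  congr (- _ - _); apply: eq_bigr => j _; congr (_ * _);
    [exact: f_line|exact: g_line].
(* At each node the metric terms of the two directions cancel, by the metric identity for both
   components of the element map. *)
have vFG : \sum_j w j * vF j + \sum_i w i * vG i = 0.
  have [mx my _] := iso e; have xi_inj := LGL_inj xi_LGL.
  have idx i j := metric_identity i j xi_inj mx.
  have idy i j := metric_identity i j xi_inj my.
  have -> : \sum_j w j * vF j = \sum_i \sum_j w i * w j *
     (pf (U e i j) * (\sum_m D i m * y_eta M e (xi m) (xi j))
      + pg (U e i j) * - (\sum_m D i m * x_eta M e (xi m) (xi j))).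
    rewrite exchange_big; apply: eq_bigr => j _ /=; rewrite mulr_sumr.
    apply: eq_bigr => i _; rewrite -sumrN mulrA [w j * _]mulrC.
    by congr (_ * (_ + _ * _)); apply: eq_bigr => m _; rewrite mulrN.
  rewrite -big_split big1// => i _ /=; rewrite mulr_sumr -big_split big1// => j _ /=.
  have -> : \sum_n D j n * - y_xi M e (xi i) (xi n) =
      - \sum_n D j n * y_xi M e (xi i) (xi n).
    by rewrite -sumrN; apply: eq_bigr => n _; rewrite mulrN.
  by rewrite /y_eta /x_eta idx idy; ring.
have sP s : \sum_l w l * edge_production (e, s) l = \sum_l w l * P s l by [].
rewrite (eq_bigr (fun s => \sum_l w l * P s l) (fun s _ => sP s)).
move: P vF vG vFG {sP}; clear => P vF vG vFG.
rewrite sum_sides.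
have sD (f g h : 'I_N.+1 -> R) : \sum_l w l * (f l + g l + h l) =
   \sum_l w l * f l + \sum_l w l * g l + \sum_l w l * h l.
  by rewrite -!big_split; apply: eq_bigr => l _; rewrite !mulrDr.
by move/eqP: vFG; rewrite addr_eq0 => /eqP vFG; rewrite !sD vFG; ring.
Qed.

End Elements.

(** * Interface terms *)

Section Interfaces.
Variables (R : realType) (N Ne : nat) (xi : 'I_N.+1 -> R) (M : mesh R Ne).
Hypotheses (N_gt0 : (0 < N)%N) (xi_LGL : LGL_nodes xi).
Hypothesis M_valid : valid_mesh M xi.
Variables (alpha : edge Ne -> 'I_N.+1 -> R).
Variables (U : 'I_Ne -> 'I_N.+1 -> 'I_N.+1 -> state R).
Hypothesis alpha_two_sided : wave_speed_two_sided M alpha.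
Variables (W : state R -> state R) (pf pg : state R -> R).
Let pot (V : state R) : vec2 R := mk_vec2 (pf V) (pg V).
Hypothesis conf_stable : forall E E' r, connect_edge M E = Conforming E' r ->
  forall i, let UL := trace U E i in let UR := trace U E' (flip_node r i) in
    dot_state (W UR - W UL) (conforming_flux xi M alpha U E E' r i)
    - dot2 (pot UR - pot UL) (node_normal xi M E i) <= 0.
Hypothesis nonconf_stable : forall C f r, connect_edge M C = CoarseOf f r ->
  forall (k : 'I_2) (i j : 'I_N.+1),
    let UF := trace U (f k) (flip_node (r k) i) in let UC := trace U C j in
    P_CF xi k i j *
      (dot_state (W UC - W UF) (nc_flux xi M alpha U k (f k) (r k) C i j)
       - dot2 (pot UC - pot UF) (nc_normal xi M (f k) (r k) C i j)) <= 0.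
Implicit Types (E F C : edge Ne) (i j l : 'I_N.+1) (k : 'I_2).
Local Notation w := (weight xi).
Local Notation ep := (edge_production xi M alpha U W pf pg).

(** The projection is the adjoint of the interpolation for the mass matrices, the factor 1/2 being
    that of [mass_F]. It gives coarse and fine sums the same coefficients. *)
Lemma P_FC_weight k l i :
  w l * P_FC xi k l i = 2%:R^-1 * (w i * P_CF xi k i l).
Proof.
have mu : mass_C xi \in unitmx.
  rewrite unitmxE det_diag unitfE; apply/prodf_neq0 => j _.
  by rewrite mxE gt_eqF// weight_gt0.
have : mass_C xi *m P_FC xi k = (P_CF xi k)^T *m mass_F xi.
  by rewrite /P_FC -mulmxA mulKVmx.
rewrite /mass_C /mass_F mul_diag_mx -scalemxAr mul_mx_diag.
move/(congr1 (fun A : 'M[R]_(N.+1) => A l i)).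
by rewrite !mxE => ->; rewrite [_ * w i]mulrC.
Qed.

Lemma flip_nodeK r : involutive (@flip_node N.+1 r).
Proof. by case: r => // i; exact: rev_ordK. Qed.

Lemma sum_flip r (F : 'I_N.+1 -> R) :
  \sum_l w l * F l = \sum_i w i * F (flip_node r i).
Proof.
rewrite (reindex_inj (inv_inj (flip_nodeK r))) /=.
by apply: eq_bigr => i _; rewrite weight_flip.
Qed.

Lemma edge_production_dot2 E l : ep E l =
  dot_state (W (trace U E l)) (numerical_flux xi M alpha U E l)
  - dot2 (pot (trace U E l)) (node_normal xi M E l).
Proof. by rewrite /edge_production dot2E !mxE. Qed.

Lemma llf_fluxN a UL UR (n : vec2 R) : llf_flux a UR UL (- n) = - llf_flux a UL UR n.
Proof.
have nN V : normal_flux V (- n) = - normal_flux V n.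
  by rewrite /normal_flux !mxE !scaleNr opprD.
have eN : enorm (- n) = enorm n by rewrite /enorm !dot2E !mxE !mulrNN.
rewrite /llf_flux eN !nN -(opprB UR UL) -opprD !scalerN opprK.
rewrite [normal_flux UR n + _]addrC [RHS]opprB.
by rewrite [LHS]addrC.
Qed.

Lemma dot2Bl (a b n : vec2 R) : dot2 (a - b) n = dot2 a n - dot2 b n.
Proof. by rewrite !dot2E !mxE; ring. Qed.

Lemma dot2Nr (a n : vec2 R) : dot2 a (- n) = - dot2 a n.
Proof. by rewrite !dot2E !mxE; ring. Qed.

Lemma conforming_production E E' r : connect_edge M E = Conforming E' r ->
  0 <= \sum_l w l * ep E l + \sum_l w l * ep E' l.
Proof.
move=> cE; have [_ conf _] := M_valid.
have [_ cE' _ nE'] := conf _ _ _ cE.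
rewrite (sum_flip r (ep E')) -big_split sumr_ge0// => i _ /=.
rewrite -mulrDr mulr_ge0 ?(ltW (weight_gt0 _ _ _))//.
have := conf_stable cE i; rewrite /= dot_stateBl dot2Bl.
rewrite !edge_production_dot2 /numerical_flux cE cE'.
have -> : conforming_flux xi M alpha U E' E r (flip_node r i) =
    - conforming_flux xi M alpha U E E' r i.
  rewrite /conforming_flux flip_nodeK (alpha_two_sided cE) /node_normal nE'.
  exact: llf_fluxN.
have -> : node_normal xi M E' (flip_node r i) = - node_normal xi M E i by exact: nE'.
rewrite dot_stateNr dot2Nr.
move: (dot_state _ _) (dot_state _ _) (dot2 _ _) (dot2 _ _) => a b c d; lra.
Qed.

(** One component of the normals: [pi] is the coarse normal, [nF] the fine ones, [q] and [p] the
    potentials on the coarse and fine sides. The averaged normal, summed against the interpolation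
    weights, gives back the true normal of either side. *)
Lemma nc_normal_balance (pi : {poly R}) (p : 'I_2 -> 'I_N.+1 -> R)
    (q : 'I_N.+1 -> R) (nF : 'I_2 -> 'I_N.+1 -> R) : (size pi <= N)%N ->
  (forall k i, nF k i = - 2%:R^-1 * pi.[Defs.half k (xi i)]) ->
  \sum_(k < 2) \sum_i \sum_j w i * (P_CF xi k i j *
    ((q j - p k i) * (2%:R^-1 * (nF k i - 2%:R^-1 * pi.[xi j])))) =
  - (\sum_(k < 2) \sum_i w i * (p k i * nF k i)) - \sum_j w j * (q j * pi.[xi j]).
Proof.
move=> spi nFE; have xi_inj := LGL_inj xi_LGL.
(* Interpolation reproduces [pi] at the fine nodes, where it is -2 times the fine normal, so each
   half of the average contributes half of [nF k i]. *)
have fine k i :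
    \sum_j P_CF xi k i j * (2%:R^-1 * (nF k i - 2%:R^-1 * pi.[xi j])) = nF k i.
  have := P_CF_exact xi_inj k i (leqW spi).
  have := sum_P_CF xi_LGL k i => s1 sp.
  transitivity (2%:R^-1 * nF k i * \sum_j P_CF xi k i j
    - 2%:R^-1 * 2%:R^-1 * \sum_j P_CF xi k i j * pi.[xi j]).
    by rewrite !mulr_sumr -sumrB; apply: eq_bigr => j _; ring.
  by rewrite s1 sp nFE; lra.
(* Both terms are quadratures over the two halves, of phi_j times [pi] and of phi_j alone; each
   contributes half of the result. *)
have coarse j : \sum_(k < 2) \sum_i w i * (P_CF xi k i j *
    (2%:R^-1 * (nF k i - 2%:R^-1 * pi.[xi j]))) = - (w j * pi.[xi j]).
  have sphi := size_lagrange xi j.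
  have d (f : {poly R}) : \sum_i w i * (lagrange_basis xi j * f).[xi i] = w j * f.[xi j].
    rewrite (bigD1 j)//= big1 => [|i ij]; last first.
      by rewrite hornerM (lagrange_node xi_inj) eq_sym (negPf ij) mul0r mulr0.
    by rewrite hornerM (lagrange_node xi_inj) eqxx mul1r addr0.
  have h1 := @LGL_halves _ _ _ N_gt0 xi_LGL (lagrange_basis xi j * pi).
  have h2 := @LGL_halves _ _ _ N_gt0 xi_LGL (lagrange_basis xi j * 1).
  rewrite !d hornerC mulr1 in h1 h2.
  transitivity (- (2%:R^-1 * 2%:R^-1) * \sum_(k < 2) \sum_i
      w i * (lagrange_basis xi j * pi).[Defs.half k (xi i)]
    - (2%:R^-1 * 2%:R^-1 * pi.[xi j]) * \sum_(k < 2) \sum_i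
      w i * (lagrange_basis xi j).[Defs.half k (xi i)]).
    rewrite !mulr_sumr -sumrB; apply: eq_bigr => k _; rewrite !mulr_sumr -sumrB.
    by apply: eq_bigr => i _; rewrite mxE nFE hornerM; ring.
  rewrite h1 ?h2; first by lra.
    by apply: leq_trans sphi _; move: N_gt0; lia.
  apply: leq_trans (size_polyMleq _ _) _.
  by move: (size _) (size pi) sphi spi N_gt0 => a b; lia.
have -> : \sum_(k < 2) \sum_i w i * (p k i * nF k i) =
    \sum_(k < 2) \sum_i \sum_j w i * (P_CF xi k i j *
      (p k i * (2%:R^-1 * (nF k i - 2%:R^-1 * pi.[xi j])))).
  apply: eq_bigr => k _; apply: eq_bigr => i _; rewrite -{1}fine !mulr_sumr.
  by apply: eq_bigr => j _; ring.
have -> : \sum_j w j * (q j * pi.[xi j]) =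
    - \sum_(k < 2) \sum_i \sum_j w i * (P_CF xi k i j *
      (q j * (2%:R^-1 * (nF k i - 2%:R^-1 * pi.[xi j])))).
  under [X in - X]eq_bigr do rewrite exchange_big.
  rewrite exchange_big /= -sumrN; apply: eq_bigr => j _.
  rewrite mulrCA -[w j * _]opprK -coarse mulrN; congr (- _).
  rewrite mulr_sumr; apply: eq_bigr => k _; rewrite mulr_sumr.
  by apply: eq_bigr => i _; ring.
rewrite opprK -!sumrN -big_split; apply: eq_bigr => k _ /=.
rewrite -!sumrN -big_split; apply: eq_bigr => i _ /=.
rewrite -!sumrN -big_split; apply: eq_bigr => j _ /=; ring.
Qed.

Lemma nonconforming_production C f r : connect_edge M C = CoarseOf f r ->
  0 <= \sum_l w l * ep C l + \sum_(k < 2) \sum_l w l * ep (f k) l.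
Proof.
move=> cC; have [iso _ [nc _]] := M_valid.
have cF k := (nc _ _ _ cC k).1; have match_k k := (nc _ _ _ cC k).2.
pose UF k i := trace U (f k) (flip_node (r k) i).
pose UC j := trace U C j.
pose nF k i := node_normal xi M (f k) (flip_node (r k) i).
pose nC j := node_normal xi M C j.
pose fx k i j := nc_flux xi M alpha U k (f k) (r k) C i j.
have xi1 := LGL_bounds N_gt0 xi_LGL.
have nCE j : nC j = mk_vec2 (normal_poly M C false).[xi j] (normal_poly M C true).[xi j].
  exact: (normal_polyE iso).
have nFE k i : nF k i = - 2%:R^-1 *: mk_vec2 (normal_poly M C false).[Defs.half k (xi i)]
    (normal_poly M C true).[Defs.half k (xi i)].
  rewrite -(normal_polyE iso) ?half_bounds// /nF /node_normal flip_nodeE//.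
  exact: (fine_normal iso (match_k k)).
have SF : \sum_(k < 2) \sum_l w l * ep (f k) l =
    \sum_(k < 2) \sum_i \sum_j w i * (P_CF xi k i j * dot_state (W (UF k i)) (fx k i j))
  - \sum_(k < 2) \sum_i w i * dot2 (pot (UF k i)) (nF k i).
  rewrite -sumrB; apply: eq_bigr => k _.
  rewrite (sum_flip (r k)) -sumrB; apply: eq_bigr => i _.
  rewrite edge_production_dot2 /numerical_flux cF flip_nodeK dot_state_sumr mulrBr.
  congr (_ - _); rewrite mulr_sumr; apply: eq_bigr => j _.
  by rewrite dot_stateZr.
(* The factor -2 of the coarse flux absorbs the 1/2 of [P_FC_weight], so the coarse side carries the
   coefficients of the fine side with opposite sign. *)
have SC : \sum_l w l * ep C l =
  - (\sum_(k < 2) \sum_i \sum_j w i * (P_CF xi k i j * dot_state (W (UC j)) (fx k i j)))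
  - \sum_j w j * dot2 (pot (UC j)) (nC j).
  under [X in - X - _]eq_bigr do rewrite exchange_big.
  rewrite exchange_big /= -sumrN -sumrB; apply: eq_bigr => l _.
  rewrite edge_production_dot2 /numerical_flux cC mulrBr; congr (_ - _).
  rewrite dot_stateZr dot_state_sumr mulrCA mulNr; congr (- _).
  rewrite !mulr_sumr; apply: eq_bigr => k _; rewrite dot_state_sumr !mulr_sumr.
  apply: eq_bigr => i _; rewrite dot_stateZr mulrA [w l * _]mulrA P_FC_weight.
  by rewrite -/(fx k i l); field.
pose kap k i j := dot_state (W (UC j) - W (UF k i)) (fx k i j)
   - dot2 (pot (UC j) - pot (UF k i)) (nc_normal xi M (f k) (r k) C i j).
have -> : \sum_l w l * ep C l + \sum_(k < 2) \sum_l w l * ep (f k) l =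
   - \sum_(k < 2) \sum_i \sum_j w i * (P_CF xi k i j * kap k i j).
  have hx := nc_normal_balance (fun k i => pf (UF k i)) (fun j => pf (UC j))
    (nF := fun k i => nF k i 0 0) (size_normal_poly iso C false).
  have hy := nc_normal_balance (fun k i => pg (UF k i)) (fun j => pg (UC j))
    (nF := fun k i => nF k i 1 0) (size_normal_poly iso C true).
  have ex k i : nF k i 0 0 = - 2^-1 * (normal_poly M C false).[Defs.half k (xi i)].
    by rewrite nFE !mxE.
  have ey k i : nF k i 1 0 = - 2^-1 * (normal_poly M C true).[Defs.half k (xi i)].
    by rewrite nFE !mxE.
  move: (hx ex) (hy ey) => {}hx {}hy.
  have kapE k i j : w i * (P_CF xi k i j * kap k i j) =
      w i * (P_CF xi k i j * dot_state (W (UC j)) (fx k i j))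
    - w i * (P_CF xi k i j * dot_state (W (UF k i)) (fx k i j))
    - w i * (P_CF xi k i j * ((pf (UC j) - pf (UF k i)) *
        (2^-1 * (nF k i 0 0 - 2^-1 * (normal_poly M C false).[xi j]))))
    - w i * (P_CF xi k i j * ((pg (UC j) - pg (UF k i)) *
        (2^-1 * (nF k i 1 0 - 2^-1 * (normal_poly M C true).[xi j])))).
    rewrite /kap dot_stateBl dot2E !mxE /= -/(nF k i) -/(nC j) nCE !mxE /=.
    by ring.
  have sE : \sum_(k < 2) \sum_i \sum_j w i * (P_CF xi k i j * kap k i j) =
      \sum_(k < 2) \sum_i \sum_j w i * (P_CF xi k i j * dot_state (W (UC j)) (fx k i j))
    - \sum_(k < 2) \sum_i \sum_j w i * (P_CF xi k i j * dot_state (W (UF k i)) (fx k i j))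
    - (- (\sum_(k < 2) \sum_i w i * (pf (UF k i) * nF k i 0 0))
       - \sum_j w j * (pf (UC j) * (normal_poly M C false).[xi j]))
    - (- (\sum_(k < 2) \sum_i w i * (pg (UF k i) * nF k i 1 0))
       - \sum_j w j * (pg (UC j) * (normal_poly M C true).[xi j])).
    rewrite -hx -hy -!sumrB; apply: eq_bigr => k _.
    rewrite -!sumrB; apply: eq_bigr => i _.
    by rewrite -!sumrB; apply: eq_bigr => j _; exact: kapE.
  have sF : \sum_(k < 2) \sum_i w i * dot2 (pot (UF k i)) (nF k i) =
      \sum_(k < 2) \sum_i w i * (pf (UF k i) * nF k i 0 0)
    + \sum_(k < 2) \sum_i w i * (pg (UF k i) * nF k i 1 0).
    rewrite -big_split; apply: eq_bigr => k _ /=; rewrite -big_split.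
    by apply: eq_bigr => i _ /=; rewrite dot2E !mk_vec2_0 !mk_vec2_1 mulrDr.
  have sC : \sum_j w j * dot2 (pot (UC j)) (nC j) =
      \sum_j w j * (pf (UC j) * (normal_poly M C false).[xi j])
    + \sum_j w j * (pg (UC j) * (normal_poly M C true).[xi j]).
    rewrite -big_split.
    by apply: eq_bigr => j _ /=; rewrite dot2E nCE !mk_vec2_0 !mk_vec2_1 mulrDr.
  rewrite SC SF sE sF sC.
  set a := (\sum_(k < 2) _); set b := (\sum_(k < 2) _); set c := (\sum_(k < 2) _).
  set d := (\sum_(k < 2) _); set g := (\sum_j _); set h := (\sum_j _).
  by ring.
rewrite oppr_ge0 sumr_le0// => k _; rewrite sumr_le0// => i _.
rewrite sumr_le0// => j _; rewrite mulr_ge0_le0 ?(ltW (weight_gt0 _ _ _))//.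
exact: nonconf_stable.
Qed.

(** * Grouping edges into interfaces *)

Definition is_conforming E := if connect_edge M E is Conforming _ _ then true else false.
Definition is_fine E := if connect_edge M E is FineOf _ _ _ then true else false.
Definition is_coarse E := if connect_edge M E is CoarseOf _ _ then true else false.
(** The default [E] makes this an involution of all edges, which can serve to reindex sums. *)
Definition neighbour E := if connect_edge M E is Conforming E' _ then E' else E.
Definition parent F := if connect_edge M F is FineOf k C _ then (C, k) else (F, ord0).
Definition child (p : edge Ne * 'I_2) :=
  if connect_edge M p.1 is CoarseOf f _ then f p.2 else p.1.

(** Each conforming interface appears once from either side; doubling the sum pairs each edge with
    its neighbour without choosing representatives. *)
Lemma sum_conforming (S : edge Ne -> R) :
  2%:R * \sum_(E | is_conforming E) S E =
  \sum_(E | is_conforming E) (S E + S (neighbour E)).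
Proof.
have [_ conf _] := M_valid.
have nbK : involutive neighbour.
  move=> E; rewrite /neighbour.
  case cE : (connect_edge M E) => [E' r|k C r|f r]; rewrite ?cE//.
  by have [_ -> _ _] := conf _ _ _ cE.
have nbC E : is_conforming (neighbour E) = is_conforming E.
  rewrite /is_conforming /neighbour.
  case cE : (connect_edge M E) => [E' r|k C r|f r]; rewrite ?cE//.
  by have [_ -> _ _] := conf _ _ _ cE.
rewrite big_split /= mulr_natl mulr2n; congr (_ + _).
rewrite (reindex_inj (inv_inj nbK)) /=.
by apply: eq_bigl => E; rewrite nbC.
Qed.

Lemma sum_fine (S : edge Ne -> R) :
  \sum_(F | is_fine F) S F =
  \sum_(C | is_coarse C) \sum_(k < 2) S (child (C, k)).
Proof.
have [_ _ [nc1 nc2]] := M_valid.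
rewrite (reindex_onto child parent) /=; last first.
  move=> F; rewrite /is_fine /parent.
  case cF : (connect_edge M F) => [|k C r|]// _.
  by have [f [r' [cC fk _]]] := nc2 _ _ _ _ cF; rewrite /child /= cC.
rewrite pair_big_dep /=; apply: eq_big => [[C k]|[C k] _]//=.
rewrite andbT /is_coarse /is_fine /child /=.
(* If [C] is itself fine, [child] returns [C] by default; its parent is a coarse edge, hence not
   [C], and the pair drops out of the reindexed sum. *)
case cC : (connect_edge M C) => [E' r|k' C' r|f r]; rewrite ?cC//=.
  have [f [r' [cC' _ _]]] := nc2 _ _ _ _ cC.
  rewrite /parent cC; apply/negP => /eqP [e _].
  by move: cC; rewrite -e cC'.
by rewrite /parent (nc1 _ _ _ cC k).1 eqxx.
Qed.

Lemma total_production_ge0 : 0 <= \sum_E \sum_l w l * ep E l.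
Proof.
pose S E := \sum_l w l * ep E l.
have -> : \sum_E \sum_l w l * ep E l = \sum_(E | is_conforming E) S E
    + (\sum_(E | is_coarse E) S E + \sum_(E | is_fine E) S E).
  rewrite [in RHS]big_mkcond [X in _ + (X + _)]big_mkcond.
  rewrite [X in _ + (_ + X)]big_mkcond -!big_split.
  apply: eq_bigr => E _; rewrite /is_conforming /is_coarse /is_fine /=.
  by case: (connect_edge M E) => *; rewrite ?addr0 ?add0r.
rewrite sum_fine -big_split addr_ge0//.
  rewrite -(@pmulr_rge0 _ 2%:R)// sum_conforming sumr_ge0// => E.
  rewrite /is_conforming /neighbour; case cE : (connect_edge M E) => [E' r||]// _.
  exact: conforming_production cE.
rewrite sumr_ge0// => C; rewrite /is_coarse /child /=.
case cC : (connect_edge M C) => [||f r]// _.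
exact: nonconforming_production cC.
Qed.

End Interfaces.

(** * Global balances *)

Section GlobalBalance.
Variables (R : realType) (N Ne : nat) (xi : 'I_N.+1 -> R) (M : mesh R Ne).
Hypotheses (N_gt0 : (0 < N)%N) (xi_LGL : LGL_nodes xi).
Hypothesis M_valid : valid_mesh M xi.
Variables (fsharp gsharp : state R -> state R -> state R).
Hypothesis vol : volume_flux fsharp gsharp.
Variables (alpha : edge Ne -> 'I_N.+1 -> R).
Variables (U dU : 'I_Ne -> 'I_N.+1 -> 'I_N.+1 -> state R).
Hypothesis U_adm : forall e i j, admissible (U e i j).
Hypothesis alpha_two_sided : wave_speed_two_sided M alpha.
Hypothesis scheme : forall e i j,
  dgsem_residual xi M fsharp gsharp alpha U dU e i j = 0.
Local Notation w := (weight xi).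

Lemma sum_production W pf pg :
  (forall UL UR, admissible UL -> admissible UR ->
     dot_state (W UR - W UL) (fsharp UL UR) = pf UR - pf UL) ->
  (forall UL UR, admissible UL -> admissible UR ->
     dot_state (W UR - W UL) (gsharp UL UR) = pg UR - pg UL) ->
  \sum_e \sum_i \sum_j w i * w j * jac M e (xi i) (xi j)
    * dot_state (W (U e i j)) (dU e i j) =
  - \sum_E \sum_l w l * edge_production xi M alpha U W pf pg E l.
Proof.
move=> f_pot g_pot; have [iso _ _] := M_valid.
have [[f_cons g_cons] [f_sym g_sym] _ _] := vol.
rewrite (eq_bigr (fun E : edge Ne => \sum_l w l *
  edge_production xi M alpha U W pf pg (E.1, E.2) l)); last by case.
rewrite -(pair_bigA _ (fun e s => \sum_l w l *
  edge_production xi M alpha U W pf pg (e, s) l)) -sumrN.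
apply: eq_bigr => e _.
exact: (element_balance N_gt0 xi_LGL iso f_sym g_sym f_cons g_cons U_adm
  f_pot g_pot (scheme e)).
Qed.

Lemma dgsem_conservative :
  \sum_e \sum_i \sum_j (w i * w j * jac M e (xi i) (xi j)) *: dU e i j = 0.
Proof.
(* A sign for every constant test vector suffices: a basis row and its negative bound each component
   from both sides. *)
suff le0 (v : state R) : \sum_e \sum_i \sum_j w i * w j * jac M e (xi i) (xi j)
    * dot_state v (dU e i j) <= 0.
  have eqv (v : state R) : dot_state v (\sum_e \sum_i \sum_j
      (w i * w j * jac M e (xi i) (xi j)) *: dU e i j) =
      \sum_e \sum_i \sum_j w i * w j * jac M e (xi i) (xi j) * dot_state v (dU e i j).
    rewrite dot_state_sumr; apply: eq_bigr => e _.
    rewrite dot_state_sumr; apply: eq_bigr => i _.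
    by rewrite dot_state_sumr; apply: eq_bigr => j _; rewrite dot_stateZr.
  have dotN (v X : state R) : dot_state (- v) X = - dot_state v X.
    by rewrite /dot_state /dot -sumrN; apply: eq_bigr => k _; rewrite mxE mulNr.
  apply/rowP => k; rewrite [RHS]mxE -[LHS]dot_state_delta; apply/le_anti.
  rewrite {1}eqv le0 /=.
  have := le0 (- delta_mx 0 k); rewrite -eqv dotN; lra.
rewrite (@sum_production (fun=> v) (fun=> 0) (fun=> 0)); last 2 first.
- by move=> *; rewrite !subrr dot_state0l.
- by move=> *; rewrite !subrr dot_state0l.
(* For a constant test function and zero potentials all jumps vanish, so both stability conditions
   hold with equality. *)
rewrite oppr_le0; apply: total_production_ge0 => //.
- move=> E E' r cE i /=; rewrite !subrr dot_state0l sub0r dot2E !mxE.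
  by rewrite !mul0r addr0 oppr0.
- move=> C f r cC k i j /=; rewrite !subrr dot_state0l sub0r dot2E !mxE.
  by rewrite !mul0r addr0 oppr0 mulr0.
Qed.

Lemma dgsem_entropy_stable :
  conforming_entropy_stable xi M alpha U ->
  nonconforming_entropy_stable xi M alpha U ->
  \sum_e \sum_i \sum_j w i * w j * jac M e (xi i) (xi j)
    * dot_state (entropy_vars (U e i j)) (dU e i j) <= 0.
Proof.
have [_ _ f_ec g_ec] := vol; move=> conf nonconf.
rewrite (sum_production f_ec g_ec) oppr_le0.
exact: total_production_ge0.
Qed.

End GlobalBalance.

Theorem theorem1 (R : realType) (N Ne : nat) (hN : (1 <= N)%N)
  (xi : 'I_N.+1 -> R) (hxi : LGL_nodes xi)
  (M : mesh R Ne) (hM : valid_mesh M xi)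
  (fsharp gsharp : state R -> state R -> state R)
  (hvol : volume_flux fsharp gsharp)
  (T : R)
  (U : R -> 'I_Ne -> 'I_N.+1 -> 'I_N.+1 -> state R)
  (alpha : R -> edge Ne -> 'I_N.+1 -> R)
  (halpha : forall t, 0 < t < T -> wave_speed_two_sided M (alpha t))
  (hadm : forall t e i j, 0 < t < T -> admissible (U t e i j))
  (hder : forall t e i j, 0 < t < T -> derivable (fun s => U s e i j) t 1)
  (hscheme : forall t e i j, 0 < t < T ->
     dgsem_residual xi M fsharp gsharp (alpha t) (U t)
       (fun e i j => derive1 (fun s => U s e i j) t) e i j = 0)
  (hconf : forall t, 0 < t < T ->
     conforming_entropy_stable xi M (alpha t) (U t))
  (hnonconf : forall t, 0 < t < T ->
     nonconforming_entropy_stable xi M (alpha t) (U t)) :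
  forall t, 0 < t < T ->
    \sum_(e < Ne) \sum_(i < N.+1) \sum_(j < N.+1)
      (weight xi i * weight xi j * jac M e (xi i) (xi j))
        *: derive1 (fun s => U s e i j) t = 0 /\
    \sum_(e < Ne) \sum_(i < N.+1) \sum_(j < N.+1)
      weight xi i * weight xi j * jac M e (xi i) (xi j)
        * derive1 (fun s => entropy (U s e i j)) t <= 0.
Proof.
move=> t tT; split.
  exact: (dgsem_conservative hN hxi hM hvol
    (fun e i j => hadm t e i j tT) (halpha t tT) (fun e i j => hscheme t e i j tT)).
under eq_bigr => e _ do under eq_bigr => i _ do under eq_bigr => j _ do
  rewrite (entropy_chain_rule (hadm t e i j tT) (hder t e i j tT)).
exact: (dgsem_entropy_stable hN hxi hM hvol
  (fun e i j => hadm t e i j tT) (halpha t tT) (fun e i j => hscheme t e i j tT)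
  (hconf t tT) (hnonconf t tT)).
Qed.
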